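(* Let $y(E)=(\lambda(E),\mu(E),w(E)^\top,x(E)^\top)^\top$ be the solution of the problem $$y'(E)=J(y(E))^{-1}e_2\quad (E\le E_{\mathrm{uw}}),\qquad y(E_{\mathrm{uw}})=y^*,$$ defined on its maximal interval of existence $(E_{\min},E_{\mathrm{uw}}]$. Assume $E_{\min}>0$, and assume moreover that there is a constant $s_0>0$ such that $$A^\top W(E)A\succeq s_0^2I_n\qquad\text{for all }E\in(E_{\min},E_{\mathrm{uw}}],\qquad W(E)=\mathrm{diag}(w(E)).$$ Then, among the following three possible finite breakdown behaviors as $E\downarrow E_{\min}$: (i) $\|y(E)\|\to+\infty$; (ii) $y(E)$ remains bounded but approaches the boundary of $\mathcal D$, i.e. some weight $w_i(E)\to0$; (iii) $y(E)$ remains bounded and inside $\mathcal D$ but $J(y(E))$ becomes singular; the only possible one is (iii), loss of invertibility of $J$.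
   Context: Let $m\ge n$, $A\in\mathbb{R}^{m\times n}$ of full column rank with rows $a_i^\top$, $b\in\mathbb{R}^m$, $u=(1,\dots,1)^\top\in\mathbb{R}^m$, $x^*=(A^\top A)^{-1}A^\top b$, $r^*=Ax^*-b$, $E_{\mathrm{uw}}=\frac1m\|r^*\|_2^2$; it is assumed that $|r^*|$ is not a constant vector. $W=\mathrm{diag}(w)$, $r=Ax-b$; logarithm and squares of vectors are componentwise. $Q\succeq s_0^2I_n$ means $z^\top Qz\ge s_0^2\|z\|^2$ for all $z\in\mathbb{R}^n$. For $y=(\lambda,\mu,w^\top,x^\top)^\top$ and a parameter $E$, let $F(y;E)=(F_1,F_2,F_3^\top,F_4^\top)^\top\in\mathbb{R}^{2+m+n}$ with $$F_1=u^\top w-1,\quad F_2=w^\top r^2-E,\quad F_3=\log w+(1+\lambda)u+\mu r^2,\quad F_4=A^\top WAx-A^\top Wb.$$ $J(y)=\nabla_yF$ is the $(2+m+n)\times(2+m+n)$ Jacobian of $F$ with respect to $y$ (independent of $E$); at points where $F_4=0$ (in particular along the solution) it equals $$J(y)=\begin{pmatrix}0&0&u^\top&0^\top\\ 0&0&(r^2)^\top&0^\top\\ u&r^2&W^{-1}&2\mu\,\mathrm{diag}(r)A\\ 0&0&(\mathrm{diag}(r)A)^\top&A^\top WA\end{pmatrix}.$$ $e_2$ is the second standard basis vector of $\mathbb{R}^{2+m+n}$. The ordinary least squares critical point is $y^*=(-(1+\log\frac1m),\,0,\,\frac1m u^\top,\,(x^* )^\top)^\top$. The domain is $\mathcal D=\mathbb{R}\times\mathbb{R}\times\Delta_m^\circ\times\mathbb{R}^n$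 with $\Delta_m^\circ=\{w\in\mathbb{R}^m: w_i>0\ \forall i,\ \sum_i w_i=1\}$; the right-hand side $J(y)^{-1}e_2$ is considered where $J(y)$ is invertible. The differential problem arises by differentiating $F(y(E);E)=0$ in $E$, and it is solved in the direction of decreasing $E$, only for positive values of $E$. *)

(* Defs.v *)
From HB Require Import structures.
From mathcomp Require Import all_boot all_order all_algebra.
From mathcomp Require Import all_classical all_reals all_analysis.
Set Implicit Arguments.
Unset Strict Implicit.
Unset Printing Implicit Defensive.
Import Order.TTheory GRing.Theory Num.Theory.
Import numFieldNormedType.Exports.
Local Open Scope classical_set_scope.
Local Open Scope ring_scope.

Section EntropicLeastSquares.
Context {R : realType} {m n : nat}.
Variables (A : 'M[R]_(m, n)) (b : 'cV[R]_m).

Definition vsq (v : 'cV[R]_m) : 'cV[R]_m := map_mx (fun t => t ^+ 2) v.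

Definition loewner_ge (Q : 'M[R]_n) (c : R) : Prop :=
  forall z : 'cV[R]_n, c * \sum_i z i 0 ^+ 2 <= (z^T *m Q *m z) 0 0.

Definition ls_solution : 'cV[R]_n := invmx (A^T *m A) *m A^T *m b.
Definition ls_residual : 'cV[R]_m := A *m ls_solution - b.
Definition E_uw : R := m%:R^-1 * \sum_i ls_residual i 0 ^+ 2.

(* The unknown (lambda, mu, w^T, x^T)^T is stored as a row vector, because the
   library's differential calculus on R^N is set up on 'rV_N; its blocks w and
   x are read off as column vectors. *)
Definition state := 'rV[R]_(2 + m + n).

Definition mk_state (l mu : R) (w : 'cV[R]_m) (x : 'cV[R]_n) : state :=
  row_mx (row_mx (\row_(k < 2) (if k == 0 then l else mu)) w^T) x^T.

Definition lam_of (y : state) : R := lsubmx (lsubmx y) 0 0.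
Definition mu_of (y : state) : R := lsubmx (lsubmx y) 0 1.
Definition w_of (y : state) : 'cV[R]_m := (rsubmx (lsubmx y))^T.
Definition x_of (y : state) : 'cV[R]_n := (rsubmx y)^T.
Definition W_of (y : state) : 'M[R]_m := diag_mx (w_of y)^T.
Definition res_of (y : state) : 'cV[R]_m := A *m x_of y - b.

Definition F1 (y : state) : R := \sum_i w_of y i 0 - 1.
Definition F2 (E : R) (y : state) : R :=
  ((w_of y)^T *m vsq (res_of y)) 0 0 - E.
Definition F3 (y : state) : 'cV[R]_m :=
  map_mx (@ln R) (w_of y) + const_mx (1 + lam_of y)
  + mu_of y *: vsq (res_of y).
Definition F4 (y : state) : 'cV[R]_n :=
  A^T *m W_of y *m A *m x_of y - A^T *m W_of y *m b.
Definition F (E : R) (y : state) : state := mk_state (F1 y) (F2 E y) (F3 y) (F4 y).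

(* The library's ['J f p] acts on row vectors from the right, [v *m 'J f p], so
   the matrix of partial derivatives (one row per component of F) is its
   transpose. E enters F only as an additive constant, so the Jacobian may be
   computed at E = 0. *)
Definition Jac (y : state) : 'M[R]_(2 + m + n) := ('J (F 0) y)^T.

Definition e2 : 'cV[R]_(2 + m + n) := delta_mx (lshift n (lshift m 1)) 0.

Definition ode_rhs (y : state) : state := (invmx (Jac y) *m e2)^T.

Definition y_star : state :=
  mk_state (- (1 + ln (m%:R^-1 : R))) 0 (const_mx m%:R^-1) ls_solution.

Definition ode_domain : set state :=
  [set y | (forall i, 0 < w_of y i 0) /\ \sum_i w_of y i 0 = 1].

(* [y] solves the initial value problem on ]a, E_uw]; the derivative at the
   right endpoint is one-sided, and values of [y] outside ]a, E_uw] are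
   irrelevant. *)
Definition is_solution (a : R) (y : R -> state) : Prop :=
  [/\ y E_uw = y_star,
      (forall E, E \in `]a, E_uw] -> ode_domain (y E) /\ Jac (y E) \in unitmx),
      (forall E, E \in `]a, E_uw[ -> is_derive E 1 y (ode_rhs (y E))) &
      h^-1 *: (y (E_uw + h) - y E_uw) @[h --> 0^'-] --> ode_rhs (y E_uw)].

(* The problem is only considered for E > 0, hence the bound [0 <= a]. *)
Definition is_maximal_solution (Emin : R) (y : R -> state) : Prop :=
  [/\ 0 <= Emin, Emin < E_uw, is_solution Emin y &
      ~ exists a z, [/\ 0 <= a, a < Emin, is_solution a z &
          forall E, E \in `]Emin, E_uw] -> z E = y E]].

(* [`|y|] is the library's sup norm on row vectors; it is equivalent to the
   Euclidean one, which is all that matters for the notions below. *)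
Definition bounded_solution (Emin : R) (y : R -> state) : Prop :=
  exists M : R, forall E, E \in `]Emin, E_uw] -> `|y E| <= M.

Definition blow_up (Emin : R) (y : R -> state) : Prop :=
  `|y E| @[E --> Emin^'+] --> +oo.

Definition reaches_boundary (Emin : R) (y : R -> state) : Prop :=
  bounded_solution Emin y /\
  exists i, w_of (y E) i 0 @[E --> Emin^'+] --> (0 : R).

(* Remaining inside the domain up to the breakdown means that the weights stay
   away from 0, uniformly in E. *)
Definition loses_invertibility (Emin : R) (y : R -> state) : Prop :=
  [/\ bounded_solution Emin y,
      (exists2 c : R, 0 < c &
         forall E, E \in `]Emin, E_uw] -> forall i, c <= w_of (y E) i 0) &
      \det (Jac (y E)) @[E --> Emin^'+] --> (0 : R)].

End EntropicLeastSquares.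

(* Main.v *)
Require Import Defs.
From HB Require Import structures.
From mathcomp Require Import all_boot all_order all_algebra.
From mathcomp Require Import all_classical all_reals all_analysis.
From mathcomp Require Import ring lra.
Set Implicit Arguments.
Unset Strict Implicit.
Unset Printing Implicit Defensive.
Import Order.TTheory GRing.Theory Num.Theory.
Import numFieldNormedType.Exports.
Local Open Scope classical_set_scope.
Local Open Scope ring_scope.

(** Why the theorem holds.  Along the solution, F (y E; E) stays equal to zero
    ([solution_equilibrium]): the weights are Gibbs weights
    w_i = exp (- (1 + lambda) - mu r_i^2), their mean of r^2 is E, and x solves
    the weighted normal equations.  The coercivity of A^T W A bounds x, hence r
    ([equilibrium_x_bounded]).  The multiplier mu is nonnegative, because Gibbs
    weights with mu < 0 would favour large residuals, whereas for E < E_uw the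
    weighted mean of r^2 lies below the uniform one ([equilibrium_mu_ge0]).
    Once mu is bounded above, the Gibbs formula keeps the weights away from 0
    and lambda bounded ([path_weights_bounded_below], [path_bounded]), which
    rules out (i) and (ii).

    The heart of the matter is the upper bound on mu ([path_mu_bounded]).
    Eliminating lambda, mu and w from J leaves a symmetric n x n matrix, the
    Schur complement S = A^T W A - 2 mu (...) of [reduced_hessian].  A kernel
    vector of S lifts to a kernel vector of J ([reduced_hessian_unitmx]), so S
    is invertible along the solution; it is A^T W A at the start, where mu = 0,
    and therefore remains positive definite
    ([posdef_continuation], [path_second_order]).  Positivity of S says that
    2 mu |q|^2 <= |A z|^2 in L^2(w), where q is the part of r (A z) orthogonal
    to 1 and r^2.  If mu blew up, then E would tend to Emin, the weights would
    concentrate on the indices where r^2 tends to Emin > 0, and the mass eps of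
    the other indices would tend to 0.  As E > Emin, comparing the energies at
    x and at a limit point of x shows that eps > 0 and that r^2 - E is
    O(sqrt eps) on the first set of indices; on the second it is bounded below.
    Hence a fixed share of the L^2(w)-norm of r^2 - E sits on a set of
    vanishing mass, so r^2 - E is not asymptotically parallel to r (A z) and
    |q|^2 stays bounded below, which contradicts the bound above
    ([concentration_estimate], [multiplier_no_blow_up]).

    Finally, if det J did not tend to 0, compactness would give a limit point p
    of the solution at which J is invertible and F (p) = Emin e_2.  The inverse
    function theorem along the line of direction e_2 ([local_solution_curve])
    gives a curve of equilibria through p, defined on both sides of Emin, with
    which the solution coincides to the right of Emin.  Gluing the two extends
    the solution below Emin > 0 ([solution_extends]), against maximality. *)


(** * Calculus in R^N and the inverse function theorem along a line *)

Lemma mx_coord_le (R : realDomainType) m n (M : 'M[R]_(m, n)) i j :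
  `|M i j| <= `|M|.
Proof.
by rewrite [leRHS]/Num.Def.normr/= mx_normrE; exact: (le_bigmax _ _ (i, j)).
Qed.

Lemma mx_norm_le (R : realDomainType) m n (M : 'M[R]_(m, n)) c :
  0 <= c -> (forall i j, `|M i j| <= c) -> `|M| <= c.
Proof.
move=> c0 Mc; rewrite [leLHS]/Num.Def.normr/= mx_normrE.
by apply: bigmax_le => // -[i j] _ /=.
Qed.

Lemma norm_mulmx_le (R : realDomainType) m n p (A : 'M[R]_(m, n)) (B : 'M[R]_(n, p)) :
  `|A *m B| <= n%:R * (`|A| * `|B|).
Proof.
apply: mx_norm_le => [|i j]; first by rewrite !mulr_ge0.
rewrite mxE (le_trans (ler_norm_sum _ _ _))//.
rewrite mulr_natl -[X in _ *+ X](card_ord n) -sumr_const.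
by apply: ler_sum => k _; rewrite normrM ler_pM ?mx_coord_le.
Qed.

Lemma cvg_sum_ord (T : Type) (R : realType) n (f : 'I_n -> T -> R)
    (l : 'I_n -> R) (F : set_system T) {FF : Filter F} :
  (forall i, f i x @[x --> F] --> l i) ->
  \sum_i f i x @[x --> F] --> \sum_i l i.
Proof. by move=> fl; apply: cvg_big => //; exact: add_continuous. Qed.

Lemma cvg_prod_ord (T : Type) (R : realType) n (f : 'I_n -> T -> R)
    (l : 'I_n -> R) (F : set_system T) {FF : Filter F} :
  (forall i, f i x @[x --> F] --> l i) ->
  \prod_i f i x @[x --> F] --> \prod_i l i.
Proof. by move=> fl; apply: cvg_big => //; exact: mul_continuous. Qed.

Lemma cvg_det (T : Type) (R : realType) n (G : T -> 'M[R]_n) (L : 'M[R]_n)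
    (F : set_system T) {FF : Filter F} :
  (forall i j, G x i j @[x --> F] --> L i j) ->
  \det (G x) @[x --> F] --> \det L.
Proof.
move=> GL; apply: cvg_big => [|s _]; first exact: add_continuous.
by apply: cvgMl_tmp; apply: cvg_prod_ord => i; exact: GL.
Qed.

(** Both sides are limits of the same difference quotients. *)
Lemma is_derive_along_line (R : realType) (V W : normedModType R) (f : V -> W)
    (v w : V) (s : R) :
  differentiable f (v + s *: w) ->
  is_derive s 1 (fun t : R => f (v + t *: w)) ('D_w f (v + s *: w)).
Proof.
move=> df; have dfw : derivable f (v + s *: w) w by exact: diff_derivable.
have E : (fun h : R => h^-1 *: (f (v + (h *: 1%R + s) *: w) - f (v + s *: w))) =
    (fun h : R => h^-1 *: (f (h *: w + (v + s *: w)) - f (v + s *: w))).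
  by apply/funext => h; rewrite [h *: 1%R]mulr1 scalerDl addrCA.
by apply: DeriveDef; rewrite /derivable /derive E.
Qed.

Lemma is_derive_coord (R : realType) (V : normedModType R) m n
    (f : V -> 'M[R]_(m, n)) (x v : V) (df : 'M[R]_(m, n)) i j :
  is_derive x v f df -> is_derive x v (fun t => f t i j) (df i j).
Proof.
move=> [fx <-]; apply: DeriveDef; first exact: (derivable_mxP _ _ _).1.
by rewrite derive_mx// mxE.
Qed.

(** The mean value theorem, applied to each coordinate of F along the segment
    from v to u, replaces the increment of F by the Jacobian at a point of the
    segment, and that Jacobian is close to the one at p. *)
Lemma strict_differentiability (R : realType) N M (F : 'rV[R]_N -> 'rV[R]_M)
    (p : 'rV[R]_N) :
  (\forall q \near p, differentiable F q) ->
  (forall i j, {for p, continuous (fun q => 'J F q i j)}) ->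
  forall eps : R, 0 < eps -> exists2 r : R, 0 < r & forall u v : 'rV[R]_N,
    `|u - p| < r -> `|v - p| < r ->
    `|F u - F v - (u - v) *m 'J F p| <= eps * `|u - v|.
Proof.
move=> dF cJ eps eps0.
set e := eps / N.+1%:R.
have e0 : 0 < e by rewrite divr_gt0.
have : \forall q \near p, differentiable F q /\
    forall ij : 'I_N * 'I_M, `|'J F p ij.1 ij.2 - 'J F q ij.1 ij.2| < e.
  near=> q; split; first by near: q.
  near: q; apply: filter_forall => -[i j] /=.
  by move/cvgrPdist_lt : (cJ i j) => /(_ _ e0).
move=> /nbhs_normP[r /= r0 rP]; exists r => // u v up vp.
apply: mx_norm_le => [|i j]; first by rewrite mulr_ge0// ltW.
rewrite ord1 {i}; set w := u - v.
have -> : (F u - F v - w *m 'J F p) 0 j = F u 0 j - F v 0 j - (w *m 'J F p) 0 j.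
  by rewrite !mxE.
have seg (s : R) : s \in `[0, 1] -> ball_ Num.norm p r (v + s *: w).
  rewrite in_itv/= => /andP[s0 s1].
  have -> : p - (v + s *: w) = (1 - s) *: (p - v) + s *: (p - u).
    by apply/matrixP => a c; rewrite !mxE; ring.
  rewrite /= (le_lt_trans (ler_normD _ _))// !normrZ.
  rewrite (distrC p) (distrC p) !ger0_norm ?subr_ge0//.
  have [->|s1'] := eqVneq s 1; first by rewrite subrr mul0r add0r mul1r.
  have : (1 - s) * `|v - p| < (1 - s) * r.
    by rewrite ltr_pM2l// subr_gt0 lt_neqAle s1'.
  have : s * `|u - p| <= s * r by rewrite ler_wpM2l// ltW.
  lra.
pose g (t : R) := F (v + t *: w) 0 j.
have dg (s : R) : s \in `[0, 1] ->
    is_derive s 1 g ((w *m 'J F (v + s *: w)) 0 j).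
  move=> /seg/rP[dFs _]; rewrite -deriveEjacobian//.
  by apply: is_derive_coord; exact: is_derive_along_line.
have dgi (s : R) : s \in `]0, 1[ ->
    is_derive s 1 g ((w *m 'J F (v + s *: w)) 0 j).
  by move=> s01; apply: dg; exact: subset_itv_oo_cc s01.
have cg : {within `[0, 1], continuous g}.
  by apply: derivable_within_continuous => x /dg[].
have [c c01] := MVT_segment ler01 dgi cg.
rewrite /g subr0 mulr1 scale0r addr0 scale1r.
have -> : v + w = u by rewrite /w addrC subrK.
move=> ->.
have [_] := rP _ (seg _ c01).
move: ('J F p) ('J F (v + c *: w)) => Jp Jc JpJc.
rewrite !mxE -sumrB (le_trans (ler_norm_sum _ _ _))//.
apply: (@le_trans _ _ (\sum_(i < N) `|w| * e)).
  apply: ler_sum => i _; rewrite -mulrBr normrM ler_pM ?mx_coord_le//.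
  by rewrite distrC ltW// (JpJc (i, j)).
rewrite sumr_const card_ord /e.
have -> : `|w| * (eps / N.+1%:R) *+ N = eps * `|w| * (N%:R / N.+1%:R).
  by rewrite -[LHS]mulr_natr; ring.
rewrite ler_piMr// ?mulr_ge0 ?(ltW eps0)//.
by rewrite ler_pdivrMr// mul1r ler_nat.
Unshelve. all: by end_near. Qed.

(** Joins the complete and the normed structures of matrices, which the Banach
    fixed point theorem needs together. *)
HB.instance Definition _ (R : realType) m n := NormedModule.on 'M[R]_(m, n).

(** Differentiate F (g s) = F (g t) + (s - t) e implicitly: the Lipschitz bound
    on g turns the remainder o(g s - g t) of F into o(s - t). *)
Lemma is_derive_solution_curve (R : realType) N (F : 'rV[R]_N -> 'rV[R]_N)
    (e : 'rV[R]_N) (g : R -> 'rV[R]_N) (t d C : R) :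
  0 < d ->
  (forall s, `|s - t| < d -> F (g s) = F (g t) + (s - t) *: e) ->
  (forall s, `|s - t| < d -> `|g s - g t| <= C * `|s - t|) ->
  differentiable F (g t) -> 'J F (g t) \in unitmx ->
  is_derive t 1 g (e *m invmx ('J F (g t))).
Proof.
move=> d0 Fg Cg dF uJ; set q := g t; set L := invmx ('J F q).
have Jd v : 'd F q v = v *m 'J F q by rewrite -deriveE// deriveEjacobian.
suff gl : h^-1 *: (g (h *: 1%R + t) - g t) @[h --> 0^'] --> e *m L.
  by apply: DeriveDef; [apply/cvg_ex; exists (e *m L)|exact: cvg_lim].
apply/cvgrPdist_le => eps eps0.
have C0 : 0 <= C.
  have d2 : 0 < d / 2 by rewrite divr_gt0.
  have := Cg (t + d / 2); rewrite addrAC subrr add0r (gtr0_norm d2).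
  by move=> /(_ ltac:(lra)) /(le_trans (normr_ge0 _)); rewrite pmulr_lge0.
pose K := N%:R * `|L| * C + 1.
have K0 : 0 < K by rewrite ltr_wpDl// !mulr_ge0.
have /eqaddoP/(_ (eps / K)) := diff_locally dF.
move=> /(_ (divr_gt0 eps0 K0))/nbhs_normP[r /= r0 rP].
near=> h.
have hn0 : h != 0 by near: h; exact: nbhs_dnbhs_neq.
have h0 : 0 < `|h| by rewrite normr_gt0.
have hE : h *: 1%R + t - t = h by rewrite addrK [h *: 1%R]mulr1.
have hd : `|h *: 1%R + t - t| < d by rewrite hE; near: h; exact: dnbhs0_lt.
have := Fg _ hd; have := Cg _ hd; rewrite hE -/q.
set v := g (h *: 1%R + t) - q => Cv Fv.
have vr : ball_ Num.norm 0 r v.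
  rewrite /ball_/= sub0r normrN (le_lt_trans Cv)//.
  have : `|h| < r / (C + 1).
    by near: h; apply: dnbhs0_lt; rewrite divr_gt0// ltr_wpDl.
  rewrite ltr_pdivlMr ?ltr_wpDl//; nra.
have : `|F (v + q) - (F q + 'd F q v)| <= eps / K * `|v| := rP _ vr.
have -> : v + q = g (h *: 1%R + t) by rewrite /v subrK.
rewrite Fv Jd opprD addrA [F q + _]addrC addrK.
set err := (X in `|X|) => errle.
have vE : v = h *: (e *m L) - err *m L.
  have -> : err = h *: e - v *m 'J F q.
    by [].
  by rewrite mulmxBl -scalemxAl mulmxK// opprB addrC subrK.
have -> : e *m L - h^-1 *: v = h^-1 *: (err *m L).
  by rewrite vE scalerBr scalerA mulVf// scale1r opprB addrC subrK.
rewrite normrZ normfV ler_pdivrMl//.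
apply: (le_trans (norm_mulmx_le _ _)).
apply: (@le_trans _ _ (N%:R * (eps / K * (C * `|h|) * `|L|))).
  rewrite ler_wpM2l// ler_wpM2r// (le_trans errle)//.
  by rewrite ler_wpM2l// divr_ge0 ?ltW.
have -> : N%:R * (eps / K * (C * `|h|) * `|L|) =
  `|h| * eps * ((N%:R * `|L| * C) / K) by ring.
have K1 : N%:R * `|L| * C / K <= 1 by rewrite ler_pdivrMr// mul1r lerDl.
by rewrite ler_piMr// mulr_ge0// ltW.
Unshelve. all: by end_near. Qed.


(** The inverse function theorem along the line F p + t e.  The solution g t is
    the fixed point of the simplified Newton map
    q |-> q - (F q - F p - t e) ('J F p)^-1, which by strict differentiability
    halves distances near p.  The gap between r / 2, where g lives, and r, where
    it is unique, makes the coincidence set of g with another solution curve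
    both open and closed. *)
Lemma local_solution_curve (R : realType) N (F : 'rV[R]_N -> 'rV[R]_N)
    (p e : 'rV[R]_N) (P : set 'rV[R]_N) :
  nbhs p P -> (\forall q \near p, differentiable F q) ->
  (forall i j, {for p, continuous (fun q => 'J F q i j)}) ->
  'J F p \in unitmx ->
  exists (g : R -> 'rV[R]_N) (d r : R), [/\ 0 < d, 0 < r,
    (forall t, `|t| < d -> [/\ `|g t - p| <= r / 2, P (g t),
       'J F (g t) \in unitmx, F (g t) = F p + t *: e &
       is_derive t 1 g (e *m invmx ('J F (g t)))]) &
    (forall t q, `|t| < d -> `|q - p| < r -> F q = F p + t *: e -> q = g t)].
Proof.
move=> Pp dF cJ uJ; pose L := invmx ('J F p).
pose K := N%:R * `|L| + 1.
have K0 : 0 < K by rewrite ltr_wpDl// mulr_ge0.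
have LK (v : 'rV[R]_N) : `|v *m L| <= K * `|v|.
  rewrite (le_trans (norm_mulmx_le _ _))// [X in _ * X]mulrC mulrA.
  by rewrite ler_wpM2r// lerDl.
have eps0 : 0 < 1 / (2 * K) by rewrite divr_gt0// mulr_gt0.
have [r1 r10 strict] := strict_differentiability dF cJ eps0.
have : \forall q \near p, [/\ P q, differentiable F q & 'J F q \in unitmx].
  near=> q; split; [by near: q|by near: q|].
  rewrite unitmxE unitfE; near: q.
  have : \det ('J F q) @[q --> p] --> \det ('J F p).
    exact: (@cvg_det _ _ _ (fun q => 'J F q) _ (nbhs p) _ cJ).
  move=> /cvgr_neq0; apply.
  by move: uJ; rewrite unitmxE unitfE.
move=> /nbhs_normP[r2 /= r20 near_p].
pose r := Num.min r1 r2.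
have r0 : 0 < r by rewrite lt_min r10.
have step t u v : `|u - p| < r -> `|v - p| < r ->
    `|(u - (F u - F p - t *: e) *m L) - (v - (F v - F p - t *: e) *m L)|
      <= 2^-1 * `|u - v|.
  rewrite !lt_min => /andP[ur _] /andP[vr _].
  have -> : (u - (F u - F p - t *: e) *m L) - (v - (F v - F p - t *: e) *m L) =
      - ((F u - F v - (u - v) *m 'J F p) *m L).
    rewrite [in RHS]mulmxBl mulmxK// !mulmxBl.
    by apply/matrixP => a c; rewrite !mxE; ring.
  rewrite normrN (le_trans (LK _))// mulrC -ler_pdivlMr//.
  rewrite (le_trans (strict _ _ ur vr))//.
  by rewrite div1r invfM mulrAC.
pose c := `|e *m L| + 1.
have c0 : 0 < c by rewrite ltr_wpDl.
pose d := r / 4 / c.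
have d0 : 0 < d by rewrite !divr_gt0.
pose U := closed_ball_ Num.norm p (r / 2).
have Ur q : U q -> `|q - p| < r.
  rewrite /U/closed_ball_/= distrC => /le_lt_trans; apply.
  by rewrite ltr_pdivrMr// ltr_pMr// ltr1n.
have sol t : `|t| < d -> exists2 q, U q & F q = F p + t *: e.
  move=> td.
  pose f q := q - (F q - F p - t *: e) *m L.
  have fU : {homo f : q / U q >-> U q}.
    move=> q Uq; rewrite /U/closed_ball_/= distrC.
    have -> : f q - p = f q - f p + t *: (e *m L).
      by rewrite [f p]/f subrr sub0r mulNmx opprK -scalemxAl opprD addrA subrK.
    rewrite (le_trans (ler_normD _ _))// (splitr (r / 2)) lerD//.
      rewrite (le_trans (step t _ _ (Ur _ Uq) _)) ?subrr ?normr0// mulrC.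
      by rewrite ler_pM2r ?invr_gt0// distrC.
    rewrite normrZ; have -> : r / 2 / 2 = d * c by rewrite /d mulfVK ?gt_eqF//; field.
    by rewrite ler_pM ?(ltW td)// lerDl.
  have [] := @banach_fixed_point R _ U (mkfun_fun fU).
  - exists 2^-1%:nng; split => /=; first by rewrite invf_lt1 ?ltr1n.
    move=> [u v] [/= /Ur up /Ur vp]; exact: step.
  - exact: closed_closed_ball_.
  - by exists p; rewrite /U/closed_ball_/= subrr normr0 divr_ge0// ltW.
  move=> q Uq qE; exists q => //.
  have : (F q - F p - t *: e) *m L = 0.
    have qf : q = q - (F q - F p - t *: e) *m L := qE.
    by rewrite -[LHS](subKr q) -qf subrr.
  move=> /(congr1 (mulmxr ('J F p))); rewrite /= mulmxKV// mul0mx => /eqP.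
  by rewrite subr_eq0 subr_eq addrC => /eqP.
have /choice[g gP] : forall t, exists q, `|t| < d -> U q /\ F q = F p + t *: e.
  move=> t; have [/sol[q Uq Fq]|_] := boolP (`|t| < d); first by exists q.
  by exists p.
have uniq t q : `|t| < d -> `|q - p| < r -> F q = F p + t *: e -> q = g t.
  move=> td qr Fq; have [/Ur gr Fg] := gP _ td.
  apply/eqP; rewrite -subr_eq0 -normr_le0.
  have := step t _ _ qr gr; rewrite Fq Fg ![F p + _]addrC !addrK subrr mul0mx !subr0.
  by have := normr_ge0 (q - g t); lra.
have lip s t : `|s| < d -> `|t| < d -> `|g s - g t| <= (2 * c) * `|s - t|.
  move=> sd td; have [/Ur sr Fs] := gP _ sd; have [/Ur tr Ft] := gP _ td.
  have := step t _ _ sr tr; rewrite Fs Ft ![F p + _]addrC !addrK subrr mul0mx subr0.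
  rewrite -scalerBl -scalemxAl => H.
  have : `|g s - g t| <= `|g s - (s - t) *: (e *m L) - g t| + `|s - t| * c.
    have -> : g s - g t = (g s - (s - t) *: (e *m L) - g t) + (s - t) *: (e *m L).
      by rewrite addrAC subrK.
    by rewrite (le_trans (ler_normD _ _))// addrAC lerD// normrZ ler_wpM2l// lerDl.
  by move: H; lra.
exists g, d, r; split; [exact: d0|exact: r0|move=> t td|exact: uniq].
have [Ug Fg] := gP _ td.
have gr2 : ball_ Num.norm p r2 (g t).
  by move: (Ur _ Ug); rewrite lt_min /= distrC => /andP[].
have [Pg dg ug] := near_p _ gr2.
split; [by rewrite distrC|exact: Pg|exact: ug|exact: Fg|].
have st_lt s : `|s - t| < d - `|t| -> `|s| < d.
  by have := ler_normD (s - t) t; rewrite subrK; lra.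
apply: (@is_derive_solution_curve _ _ _ _ _ _ (d - `|t|) (2 * c) _ _ _ dg ug).
- by rewrite subr_gt0.
- move=> s /st_lt sd.
  by rewrite (gP _ sd).2 Fg scalerBl -addrA [_ + (_ - _)]addrC subrK.
- by move=> s /st_lt sd; exact: lip.
Unshelve. all: by end_near. Qed.

(** * Cluster points, connectedness and continuation of positive definiteness *)

(** The condition [Q d] may become stronger as d decreases, so that the limit
    point can be approached along parameters for which, say, a quantity exceeds
    1 / d. *)
Lemma frequently_cluster (R : realType) N (y : R -> 'rV[R]_N) (a M : R)
    (Q : R -> R -> Prop) :
  (forall d d' E, d <= d' -> Q d E -> Q d' E) ->
  (forall d, 0 < d -> exists E, [/\ a < E < a + d, Q d E & `|y E| <= M]) ->
  exists p, forall d, 0 < d ->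
    exists E, [/\ a < E < a + d, Q d E & `|y E - p| < d].
Proof.
move=> Qle Qex.
pose S d := [set q | exists E, [/\ a < E < a + d, Q d E, `|y E| <= M & q = y E]].
pose G := filter_from [set d : R | 0 < d] S.
have S_sub d d' : d <= d' -> S d `<=` S d'.
  move=> dd' q [E [/andP[aE Ed] QE yM ->]]; exists E; split => //.
    by rewrite aE (lt_le_trans Ed)// lerD2l.
  exact: Qle QE.
have FG : ProperFilter G.
  apply: filter_from_proper => [|d d0]; last first.
    by have [E [aE QE yM]] := Qex d d0; exists (y E), E.
  apply: filter_from_filter; first by exists 1; exact: ltr01.
  move=> d d' d0 d'0; exists (Num.min d d'); first by rewrite /= lt_min d0 d'0.
  by rewrite subsetI; split; apply: S_sub; rewrite ge_min lexx ?orbT.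
have cK : compact (closed_ball_ Num.norm (0 : 'rV[R]_N) M).
  apply: bounded_closed_compact; last exact: closed_closed_ball_.
  exists M; split; first exact: num_real.
  move=> x Mx q; rewrite /closed_ball_/= sub0r normrN => qM; exact: le_trans qM (ltW Mx).
have [|p [_ clp]] := cK G FG.
  by exists 1; [exact: ltr01|] => q [E [_ _ yM ->]]; rewrite /closed_ball_/= sub0r normrN.
exists p => d d0.
have Gd : G (S d) by exists d.
have [q [[E [aE QE _ ->]]]] := clp _ _ Gd (nbhsx_ballx p d d0).
by rewrite -ball_normE/= distrC => pE; exists E.
Qed.

Lemma connected_clopen_ind (T : topologicalType) (I P : set T) :
  connected I -> (exists2 x, I x & P x) ->
  (forall x, I x -> P x -> \forall y \near x, I y -> P y) ->
  (forall x, I x -> ~ P x -> \forall y \near x, I y -> ~ P y) ->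
  forall x, I x -> P x.
Proof.
move=> cI [x0 Ix0 Px0] oP cP.
suff IP : I `&` P = I.
  by move=> x Ix; have : I x := Ix; rewrite -[in X in X -> _]IP => -[].
apply: cI; first by exists x0.
- exists (interior [set y | I y -> P y]); first exact: open_interior.
  apply/seteqP; split=> x [Ix].
    by move=> Px; split => //; exact: oP.
  by move=> /interior_subset /(_ Ix) Px; split.
- exists (~` interior [set y | I y -> ~ P y]).
    by apply: open_closedC; exact: open_interior.
  apply/seteqP; split=> x [Ix].
    by move=> Px; split => // /interior_subset /(_ Ix).
  move=> xn; split => //; apply: contrapT => nPx.
  by apply: xn; exact: cP.
Qed.

Section quadratic_forms.
Variables (R : realType) (n : nat).
Implicit Types (G : 'M[R]_n) (u v z : 'cV[R]_n).

Definition bil G u v : R := (u^T *m G *m v) 0 0.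

Definition posdef G := forall z, z != 0 -> 0 < bil G z z.

Lemma bilE G u v : bil G u v = \sum_i \sum_j u i 0 * G i j * v j 0.
Proof.
rewrite /bil mxE exchange_big; apply: eq_bigr => j _; rewrite mxE mulr_suml.
by apply: eq_bigr => i _; rewrite mxE.
Qed.

Lemma bilDZ G u v (s : R) : G^T = G ->
  bil G (u + s *: v) (u + s *: v) =
  bil G u u + 2 * s * bil G v u + s ^+ 2 * bil G v v.
Proof.
move=> Gsym; have symG : bil G u v = bil G v u.
  have : (u^T *m G *m v)^T = v^T *m G *m u by rewrite !trmx_mul trmxK Gsym mulmxA.
  by move=> /matrixP/(_ 0 0); rewrite mxE.
have -> : bil G (u + s *: v) (u + s *: v) =
    bil G u u + s * bil G u v + s * bil G v u + s * (s * bil G v v).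
  have uvT : (u + s *: v)^T = u^T + s *: v^T.
    by apply/matrixP => i j; rewrite !mxE.
  rewrite /bil uvT !(mulmxDl, mulmxDr) -!scalemxAl -!scalemxAr.
  by rewrite !mxE; ring.
by rewrite symG; ring.
Qed.

Lemma sum_sqr_gt0 z : z != 0 -> 0 < \sum_i z i 0 ^+ 2.
Proof.
move=> z0; rewrite lt0r sumr_ge0 ?andbT; last by move=> i _; exact: sqr_ge0.
apply: contra z0; rewrite psumr_eq0 => [/allP z0|i _]; last exact: sqr_ge0.
apply/eqP/matrixP => i j; rewrite ord1 mxE; apply/eqP.
by have := z0 i; rewrite mem_index_enum sqrf_eq0; apply.
Qed.

(** If z^T G z = 0, then for v = G z the expansion of the form at z - s v is
    negative for small s > 0 unless v = 0. *)
Lemma posdef_semi G : G^T = G -> G \in unitmx ->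
  (forall z, 0 <= bil G z z) -> posdef G.
Proof.
move=> Gsym uG Gge0 z z0; rewrite lt0r Gge0 andbT; apply/negP => /eqP Gz0.
pose v := G *m z; pose a := \sum_i v i 0 ^+ 2; pose q := bil G v v.
have a0 : 0 < a.
  apply: sum_sqr_gt0; apply: contra z0 => /eqP v0.
  by rewrite -[z](mulKmx uG) -/v v0 mulmx0.
have va : bil G v z = a.
  rewrite /bil -mulmxA mxE; apply: eq_bigr => i _.
  by rewrite mxE -/v expr2.
have q0 : 0 <= q by exact: Gge0.
have := Gge0 (z + (- (a / (q + 1))) *: v).
rewrite bilDZ// Gz0 va -/q add0r.
have -> : 2 * - (a / (q + 1)) * a + (- (a / (q + 1))) ^+ 2 * q =
    - ((a / (q + 1)) ^+ 2 * (q + 2)).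
  by field; rewrite gt_eqF// ltr_wpDl.
rewrite oppr_ge0 leNgt mulr_gt0// ?exprn_gt0 ?divr_gt0//; by rewrite ltr_wpDl.
Qed.

(** Coercivity with the explicit constant 1 / (1 + tr G^-1): Cauchy-Schwarz for
    the form G, applied to z and u = G^-1 e_i, reads
    z_i^2 <= (G^-1)_ii (z^T G z). *)
Lemma posdef_coercive G : G^T = G -> G \in unitmx -> posdef G ->
  exists2 c : R, 0 < c & forall z, c * \sum_i z i 0 ^+ 2 <= bil G z z.
Proof.
move=> Gsym uG Gpos; pose h i := invmx G i i.
have Gge0 z : 0 <= bil G z z.
  have [->|/Gpos/ltW//] := eqVneq z 0.
  by rewrite /bil mulmx0 mxE.
have hP i z : 0 < h i /\ z i 0 ^+ 2 <= h i * bil G z z.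
  pose u : 'cV[R]_n := invmx G *m delta_mx i 0.
  have Gu : G *m u = delta_mx i 0 by rewrite mulmxA mulmxV// mul1mx.
  have uGv v : bil G u v = v i 0.
    rewrite /bil -{1}Gsym -trmx_mul Gu mxE (bigD1 i)//= big1 => [|j ji].
      by rewrite !mxE !eqxx mul1r addr0.
    by rewrite !mxE (negbTE ji) mul0r.
  have uu : bil G u u = h i.
    rewrite uGv mxE (bigD1 i)//= big1 => [|j ji].
      by rewrite !mxE !eqxx mulr1 addr0.
    by rewrite !mxE (negbTE ji) mulr0.
  have h0 : 0 < h i.
    rewrite -uu Gpos//; apply/eqP => u0; move: Gu; rewrite u0 mulmx0.
    by move=> /matrixP/(_ i 0)/eqP; rewrite !mxE !eqxx eq_sym oner_eq0.
  split => //; have := Gge0 (z + (- (z i 0 / h i)) *: u).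
  rewrite bilDZ// uGv uu.
  have -> : bil G z z + 2 * - (z i 0 / h i) * z i 0 + (- (z i 0 / h i)) ^+ 2 * h i =
      bil G z z - z i 0 ^+ 2 / h i.
    by field; rewrite gt_eqF.
  by rewrite subr_ge0 ler_pdivrMr// mulrC.
pose c := \sum_i h i + 1.
have c0 : 0 < c.
  by rewrite ltr_wpDl// sumr_ge0// => i _; have [/ltW] := hP i 0.
exists c^-1 => [|z]; first by rewrite invr_gt0.
rewrite ler_pdivrMl// /c mulrDl mul1r mulr_suml.
apply: ler_wpDr; first exact: Gge0.
by apply: ler_sum => i _; have [] := hP i z.
Qed.

End quadratic_forms.

Lemma posdef_near (R : realType) n (G : R -> 'M[R]_n) (t : R) :
  (forall i j, G s i j @[s --> t] --> G t i j) ->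
  (G t)^T = G t -> G t \in unitmx -> posdef (G t) ->
  \forall s \near t, posdef (G s).
Proof.
move=> cG Gsym uG Gpos; have [c c0 cP] := posdef_coercive Gsym uG Gpos.
pose e := c / (2 * n.+1%:R).
have e0 : 0 < e by rewrite divr_gt0.
near=> s => z z0.
have near_s (ij : 'I_n * 'I_n) : `|G t ij.1 ij.2 - G s ij.1 ij.2| < e.
  move: ij; near: s; apply: filter_forall => -[i j] /=.
  by move/cvgrPdist_lt : (cG i j) => /(_ _ e0).
have q0 := sum_sqr_gt0 z0.
set q := \sum_i _ in q0.
have : bil (G t) z z - bil (G s) z z <= e * (n%:R * q).
  rewrite !bilE -sumrB.
  apply: (@le_trans _ _ (\sum_i \sum_j e * ((z i 0 ^+ 2 + z j 0 ^+ 2) / 2))).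
    apply: ler_sum => i _; rewrite -sumrB; apply: ler_sum => j _.
    apply: (le_trans (ler_norm _)).
    have -> : z i 0 * G t i j * z j 0 - z i 0 * G s i j * z j 0 =
       (G t i j - G s i j) * (z i 0 * z j 0) by ring.
    rewrite normrM; apply: ler_pM => //; first exact: ltW (near_s (i, j)).
    rewrite normrM -[z i 0 ^+ 2]real_normK ?num_real//.
    rewrite -[z j 0 ^+ 2]real_normK ?num_real//.
    have := sqr_ge0 (`|z i 0| - `|z j 0|); nra.
  under eq_bigr do rewrite -mulr_sumr.
  rewrite -mulr_sumr ler_wpM2l ?(ltW e0)//.
  under eq_bigr do rewrite -mulr_suml big_split/= sumr_const card_ord.
  rewrite -mulr_suml big_split/= sumr_const card_ord.
  rewrite -/q sumrMnl -/q -[q *+ n]mulr_natl. lra.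
have -> : e * (n%:R * q) = c * q * (n%:R / n.+1%:R) / 2.
  by rewrite /e invfM; ring.
have n1 : n%:R / n.+1%:R <= 1 :> R by rewrite ler_pdivrMr// mul1r ler_nat.
have cq : 0 < c * q by rewrite mulr_gt0.
have := cP z; rewrite -/q.
have : c * q * (n%:R / n.+1%:R) <= c * q by rewrite ler_piMr// ltW.
move: (c * q) (c * q * _) (bil (G t) z z) (bil (G s) z z) cq => a X Bt Bs.
lra.
Unshelve. all: by end_near. Qed.

(** The parameters at which G is positive definite form an open set by
    coercivity; where G is not positive definite, invertibility provides a
    direction in which the form is negative, and this persists nearby. *)
Lemma posdef_continuation (R : realType) n (G : R -> 'M[R]_n) (I : set R) t0 :
  connected I -> (forall t i j, I t -> G s i j @[s --> t] --> G t i j) ->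
  (forall t, I t -> (G t)^T = G t) -> (forall t, I t -> G t \in unitmx) ->
  I t0 -> posdef (G t0) -> forall t, I t -> posdef (G t).
Proof.
move=> conI cG Gsym uG It0 Gt0.
apply: (connected_clopen_ind (P := [set t | posdef (G t)])) => //=.
- by exists t0.
- move=> t It Gt.
  have : \forall s \near t, posdef (G s).
    by apply: posdef_near => //; [move=> i j; exact: cG|exact: Gsym|exact: uG].
  by apply: filterS.
- move=> t It nGt.
  have [z zneg] : exists z, bil (G t) z z < 0.
    apply: contrapT => nz; apply: nGt; apply: posdef_semi; [exact: Gsym|exact: uG|].
    by move=> z; rewrite leNgt; apply/negP => zn; apply: nz; exists z.
  have : bil (G s) z z @[s --> t] --> bil (G t) z z.
    under eq_fun do rewrite bilE.
    rewrite bilE; apply: cvg_sum_ord => i; apply: cvg_sum_ord => j.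
    by apply: cvgMr_tmp; apply: cvgMl_tmp; exact: cG.
  move=> /cvgr_lt/(_ _ zneg); apply: filterS => s sneg _ Gs.
  have [z0|/Gs] := eqVneq z 0; last by rewrite ltNge ltW.
  by move: zneg; rewrite z0 /bil mulmx0 mxE ltxx.
Qed.

(** * The map F and its Jacobian *)

Section is_diff_pointwise.
Context {R : realType} {V W : normedModType R}.
Implicit Types x : V.

Lemma is_diff_ext x (f f' df df' : V -> W) :
  f =1 f' -> df =1 df' -> is_diff x f df -> is_diff x f' df'.
Proof. by move=> /funext <- /funext <-. Qed.

Lemma is_diff_const (a : W) x : is_diff x (fun=> a) (fun=> 0).
Proof. exact: is_diff_cst. Qed.

Lemma is_diff_add x (f g df dg : V -> W) : is_diff x f df -> is_diff x g dg ->
  is_diff x (fun y => f y + g y) (fun v => df v + dg v).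
Proof. by move=> fx gx; apply: is_diffD. Qed.

Lemma is_diff_sum x I (r : seq I) (f df : I -> V -> W) :
  (forall i, is_diff x (f i) (df i)) ->
  is_diff x (fun y => \sum_(i <- r) f i y) (fun v => \sum_(i <- r) df i v).
Proof.
move=> fx; elim: r => [|i r IH].
  by apply: (is_diff_ext _ _ (is_diff_cst 0 x)) => v; rewrite big_nil.
by apply: (is_diff_ext _ _ (is_diff_add (fx i) IH)) => v; rewrite big_cons.
Qed.

Lemma is_diff_scalev x (f df : V -> R) (w : W) : is_diff x f df ->
  is_diff x (fun y => f y *: w) (fun v => df v *: w).
Proof.
move=> fx; apply: DiffDef; first exact: differentiableZl.
by rewrite diffZl// diff_val.
Qed.

End is_diff_pointwise.

Section is_diff_scalar.
Context {R : realType} {V : normedModType R}.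
Implicit Types (f g df dg : V -> R) (x : V).

Lemma is_diff_mul x f g df dg : is_diff x f df -> is_diff x g dg ->
  is_diff x (fun y => f y * g y) (fun v => f x * dg v + df v * g x).
Proof.
move=> fx gx; apply: (is_diff_ext _ _ (is_diffM fx gx)) => // v.
by rewrite /= !fctE [df v * _]mulrC.
Qed.

Lemma is_diff_ln x f df : 0 < f x -> is_diff x f df ->
  is_diff x (fun y => ln (f y)) (fun v => df v / f x).
Proof.
move=> fx0 fx; have lnfx := is_derive1_ln fx0.
have lnd : is_diff (f x) (@ln R) (fun h => h / f x).
  have dln : differentiable (@ln R) (f x) by apply/derivable1_diffP.
  apply: DiffDef => //; apply/funext => h.
  by rewrite diff1E// derive1E derive_val.
exact: (@is_diff_comp _ _ _ _ f df (@ln R) (fun h => h / f x) x).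
Qed.

End is_diff_scalar.

Lemma cvg_ext (T : Type) (U : topologicalType) (F : set_system T)
    (f g : T -> U) (l l' : U) :
  f =1 g -> l = l' -> f x @[x --> F] --> l -> g x @[x --> F] --> l'.
Proof. by move=> /funext <- <-. Qed.

Lemma is_diff_coord (R : realType) m n (M : 'M[R]_(m, n)) i j :
  is_diff M (fun N : 'M[R]_(m, n) => N i j) (fun N => N i j).
Proof.
apply: DiffDef; first exact: differentiable_coord.
have @f : {linear 'M[R]_(m, n) -> R}.
  by exists (fun N : 'M[R]_(_, _) => N i j); do 2![eexists]; do ?[constructor];
     rewrite ?mxE// => ? *; rewrite ?mxE//; move=> ?; rewrite !mxE.
by rewrite (_ : (fun _ => _) = f)// diff_lin//; exact: coord_continuous.
Qed.

(** Differentiability of row vectors reduces to that of their coordinates. *)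
Lemma is_diff_rV (R : realType) (V : normedModType R) N (x : V)
    (f df : V -> 'rV[R]_N) :
  (forall j, is_diff x (fun y => f y 0 j) (fun v => df v 0 j)) -> is_diff x f df.
Proof.
move=> fx.
apply: (is_diff_ext _ _ (is_diff_sum (index_enum 'I_N)
  (fun j => is_diff_scalev (delta_mx 0 j : 'rV[R]_N) (fx j)))) => v;
  by rewrite [RHS]row_sum_delta.
Qed.

Section state_coordinates.
Context {R : realType} {m n : nat}.
Implicit Types y v : @state R m n.

Definition ilam : 'I_(2 + m + n) := lshift n (lshift m 0).
Definition imu : 'I_(2 + m + n) := lshift n (lshift m 1).
Definition iw (i : 'I_m) : 'I_(2 + m + n) := lshift n (rshift 2 i).
Definition ix (j : 'I_n) : 'I_(2 + m + n) := rshift (2 + m) j.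

Lemma state_index_ind (P : 'I_(2 + m + n) -> Prop) :
  P ilam -> P imu -> (forall i, P (iw i)) -> (forall j, P (ix j)) ->
  forall k, P k.
Proof.
move=> Pl Pm Pw Px k; case: (split_ordP k) => [k' ->|j ->]; last exact: Px.
case: (split_ordP k') => [k'' ->|i ->]; last exact: Pw.
case: k'' => -[|[|//]] k2.
- by rewrite (_ : Ordinal k2 = 0)//; exact: val_inj.
- by rewrite (_ : Ordinal k2 = 1)//; exact: val_inj.
Qed.

Lemma lam_ofE y : lam_of y = y 0 ilam. Proof. by rewrite /lam_of !mxE. Qed.
Lemma mu_ofE y : mu_of y = y 0 imu. Proof. by rewrite /mu_of !mxE. Qed.
Lemma w_ofE y i : w_of y i 0 = y 0 (iw i). Proof. by rewrite /w_of !mxE. Qed.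
Lemma x_ofE y j : x_of y j 0 = y 0 (ix j). Proof. by rewrite /x_of !mxE. Qed.

Lemma mk_state_lam (l mu : R) (w : 'cV[R]_m) (x : 'cV[R]_n) :
  mk_state l mu w x 0 ilam = l.
Proof. by rewrite /mk_state row_mxEl row_mxEl mxE. Qed.
Lemma mk_state_mu (l mu : R) (w : 'cV[R]_m) (x : 'cV[R]_n) :
  mk_state l mu w x 0 imu = mu.
Proof. by rewrite /mk_state row_mxEl row_mxEl mxE. Qed.
Lemma mk_state_w (l mu : R) (w : 'cV[R]_m) (x : 'cV[R]_n) i :
  mk_state l mu w x 0 (iw i) = w i 0.
Proof. by rewrite /mk_state row_mxEl row_mxEr mxE. Qed.
Lemma mk_state_x (l mu : R) (w : 'cV[R]_m) (x : 'cV[R]_n) j :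
  mk_state l mu w x 0 (ix j) = x j 0.
Proof. by rewrite /mk_state row_mxEr mxE. Qed.
Definition mk_stateE := (mk_state_lam, mk_state_mu, mk_state_w, mk_state_x).

End state_coordinates.

Section jacobian_of_F.
Context {R : realType} {m n : nat}.
Variables (A : 'M[R]_(m, n)) (b : 'cV[R]_m).
Implicit Types y v : @state R m n.

Lemma res_ofE y i : res_of A b y i 0 = \sum_j A i j * x_of y j 0 - b i 0.
Proof. by rewrite /res_of !mxE. Qed.

Lemma F1E y : F1 y = \sum_i w_of y i 0 - 1. Proof. by []. Qed.

Lemma F2E E y : F2 A b E y = \sum_i w_of y i 0 * res_of A b y i 0 ^+ 2 - E.
Proof.
rewrite /F2 mxE; congr (_ - _).
by apply: eq_bigr => i _; rewrite mxE [vsq _ _ _]mxE.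
Qed.

Lemma F3E y i : F3 A b y i 0 =
  ln (w_of y i 0) + (1 + lam_of y) + mu_of y * res_of A b y i 0 ^+ 2.
Proof. by rewrite /F3 !mxE. Qed.

Lemma F4E y j : F4 A b y j 0 =
  \sum_i A i j * (w_of y i 0 * res_of A b y i 0).
Proof.
have -> : F4 A b y = A^T *m (W_of y *m res_of A b y).
  by rewrite /F4 /res_of !mulmxBr !mulmxA.
rewrite mxE; apply: eq_bigr => i _; rewrite mxE; congr (_ * _).
rewrite /W_of mul_diag_mx; by rewrite !mxE.
Qed.

(** The differential of F at y in the direction v; h is the increment of the
    residual. *)
Definition dF y v : @state R m n :=
  let r i := res_of A b y i 0 in let h := A *m x_of v in
  mk_state
    (\sum_i w_of v i 0)
    (\sum_i (w_of v i 0 * r i ^+ 2 + w_of y i 0 * (2 * r i * h i 0)))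
    (\col_i (w_of v i 0 / w_of y i 0 + lam_of v
             + (mu_of v * r i ^+ 2 + mu_of y * (2 * r i * h i 0))))
    (\col_j \sum_i A i j * (w_of v i 0 * r i + w_of y i 0 * h i 0)).

Lemma is_diff_w y i : is_diff y (fun y => w_of y i 0) (fun v => w_of v i 0).
Proof.
by apply: (is_diff_ext _ _ (is_diff_coord y 0 (iw i))) => v; rewrite w_ofE.
Qed.

Lemma is_diff_x y j : is_diff y (fun y => x_of y j 0) (fun v => x_of v j 0).
Proof.
by apply: (is_diff_ext _ _ (is_diff_coord y 0 (ix j))) => v; rewrite x_ofE.
Qed.

Lemma is_diff_lam y : is_diff y (@lam_of R m n) (@lam_of R m n).
Proof.
by apply: (is_diff_ext _ _ (is_diff_coord y 0 ilam)) => v; rewrite lam_ofE.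
Qed.

Lemma is_diff_mu y : is_diff y (@mu_of R m n) (@mu_of R m n).
Proof.
by apply: (is_diff_ext _ _ (is_diff_coord y 0 imu)) => v; rewrite mu_ofE.
Qed.

Lemma is_diff_res y i :
  is_diff y (fun y => res_of A b y i 0) (fun v => (A *m x_of v) i 0).
Proof.
have H := is_diff_sum (index_enum 'I_n)
  (fun j => is_diff_mul (is_diff_const (A i j) y) (is_diff_x y j)).
apply: (is_diff_ext _ _ (is_diff_add H (is_diff_const (- b i 0) y))) => v.
  by rewrite res_ofE.
by rewrite mxE addr0; apply: eq_bigr => j _; rewrite mul0r addr0.
Qed.

Lemma is_diff_res2 y i : is_diff y (fun y => res_of A b y i 0 ^+ 2)
  (fun v => 2 * res_of A b y i 0 * (A *m x_of v) i 0).
Proof.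
apply: (is_diff_ext _ _ (is_diff_mul (is_diff_res y i) (is_diff_res y i))) => v.
  by rewrite expr2.
by ring.
Qed.

Lemma is_diff_F y : (forall i, 0 < w_of y i 0) -> is_diff y (F A b 0) (dF y).
Proof.
move=> w0; apply: is_diff_rV; apply: state_index_ind => [||i|j].
- apply: (is_diff_ext _ _ (is_diff_add (is_diff_sum (index_enum 'I_m)
    (fun i => is_diff_w y i)) (is_diff_const (-1 : R) y))) => v.
    by rewrite mk_stateE.
  by rewrite mk_stateE addr0.
- apply: (is_diff_ext _ _ (is_diff_sum (index_enum 'I_m)
    (fun i => is_diff_mul (is_diff_w y i) (is_diff_res2 y i)))) => v.
    by rewrite mk_stateE F2E subr0.
  by rewrite mk_stateE; apply: eq_bigr => i _; rewrite addrC.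
- apply: (is_diff_ext _ _ (is_diff_add (is_diff_add
      (is_diff_ln (w0 i) (is_diff_w y i))
      (is_diff_add (is_diff_const (1 : R) y) (is_diff_lam y)))
    (is_diff_mul (is_diff_mu y) (is_diff_res2 y i)))) => v.
    by rewrite mk_stateE F3E.
  by rewrite mk_stateE [RHS]mxE add0r; congr (_ + _); rewrite addrC.
- apply: (is_diff_ext _ _ (is_diff_sum (index_enum 'I_m)
    (fun i => is_diff_mul (is_diff_const (A i j) y)
      (is_diff_mul (is_diff_w y i) (is_diff_res y i))))) => v.
    by rewrite mk_stateE F4E.
  rewrite mk_stateE [RHS]mxE; apply: eq_bigr => i _.
  by rewrite mul0r addr0; congr (_ * _); rewrite addrC.
Qed.

Lemma jacobian_FE y i j : (forall i, 0 < w_of y i 0) ->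
  ('J (F A b 0) y) i j = dF y (delta_mx 0 i) 0 j.
Proof.
move=> /is_diff_F dFy; rewrite -[in RHS](@diff_val _ _ _ _ _ _ _ dFy).
by rewrite /jacobian mxE.
Qed.

Lemma diff_FE y v : (forall i, 0 < w_of y i 0) -> v *m 'J (F A b 0) y = dF y v.
Proof. by move=> /is_diff_F dFy; rewrite /jacobian mul_rV_lin1 diff_val. Qed.

Lemma w_pos_near y : (forall i, 0 < w_of y i 0) ->
  \forall q \near y, forall i, 0 < w_of q i 0.
Proof.
move=> w0; near=> q; near: q; apply: filter_forall => i.
have : w_of q i 0 @[q --> y] --> w_of y i 0.
  exact: (differentiable_continuous (ex_diff (is_diff_def:=is_diff_w y i))).
by move=> /cvgr_gt; apply.
Unshelve. all: by end_near. Qed.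

Lemma differentiable_F_near y : (forall i, 0 < w_of y i 0) ->
  \forall q \near y, differentiable (F A b 0) q.
Proof. by move=> /w_pos_near; apply: filterS => q /is_diff_F[]. Qed.

Lemma continuous_jacobian_F y i j : (forall i, 0 < w_of y i 0) ->
  {for y, continuous (fun q => 'J (F A b 0) q i j)}.
Proof.
move=> w0; set v := delta_mx 0 i : 'rV[R]_(2 + m + n).
suff : dF q v 0 j @[q --> y] --> dF y v 0 j.
  move=> cdF; have Jy := esym (jacobian_FE i j w0).
  have Jnear : {near y, (fun q => dF q v 0 j) =1 (fun q => 'J (F A b 0) q i j)}.
    by apply: filterS (w_pos_near w0) => q w0q; exact: esym (jacobian_FE i j w0q).
  apply: (cvg_trans (near_eq_cvg Jnear)).
  exact: (eq_ind _ (fun z : R => dF q v 0 j @[q --> y] --> z) cdF _ Jy).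
have cw k : w_of q k 0 @[q --> y] --> w_of y k 0.
  exact: (differentiable_continuous (ex_diff (is_diff_def:=is_diff_w y k))).
have cr k : res_of A b q k 0 @[q --> y] --> res_of A b y k 0.
  exact: (differentiable_continuous (ex_diff (is_diff_def:=is_diff_res y k))).
have cr2 k : res_of A b q k 0 ^+ 2 @[q --> y] --> res_of A b y k 0 ^+ 2.
  exact: (differentiable_continuous (ex_diff (is_diff_def:=is_diff_res2 y k))).
have cmu : mu_of q @[q --> y] --> mu_of y.
  exact: (differentiable_continuous (ex_diff (is_diff_def:=is_diff_mu y))).
have c2r k c : 2 * res_of A b q k 0 * c @[q --> y] --> 2 * res_of A b y k 0 * c.
  by apply: cvgM (cvgM (cvg_cst _) (cr k)) (cvg_cst _).
pose h k := (A *m x_of v) k 0.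
have cc (c : R) : (fun _ : @state R m n => c) q @[q --> y] --> c.
  exact: (@cvg_cst _ _ _ _ (nbhs_filter y)).
move: j; apply: state_index_ind => [||k|k].
- apply: (cvg_ext _ _ (cc (\sum_i w_of v i 0))) => [q|]; by rewrite mk_stateE.
- apply: (cvg_ext _ _ (cvg_sum_ord (fun k => cvgD
    (cvgM (cc (w_of v k 0)) (cr2 k)) (cvgM (cw k) (c2r k (h k)))))) => [q|];
  by rewrite mk_stateE.
- have wk0 : w_of y k 0 != 0 by rewrite gt_eqF.
  apply: (cvg_ext _ _ (cvgD (cvgD (cvgM (cc (w_of v k 0)) (cvgV wk0 (cw k)))
      (cc (lam_of v)))
    (cvgD (cvgM (cc (mu_of v)) (cr2 k)) (cvgM cmu (c2r k (h k)))))) => [q|];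
  by rewrite mk_stateE [RHS]mxE.
- apply: (cvg_ext _ _ (cvg_sum_ord (fun i => cvgM (cc (A i k))
    (cvgD (cvgM (cc (w_of v i 0)) (cr i)) (cvgM (cw i) (cc (h i))))))) => [q|];
  by rewrite mk_stateE [RHS]mxE.
Qed.

End jacobian_of_F.

(** * Gibbs weights and concentration *)

(** Where rho^2 <= C eps, the square (u - alpha rho)^2 is worth at least
    theta (u^2 / 2 - alpha^2 rho^2); on the set o, of mass eps, it is worth at
    least alpha^2 rho^2 / 2 - u^2.  With theta C = g^2 / 2 the terms in alpha
    cancel after summation, so the bound is uniform in alpha. *)
Lemma concentration_estimate (R : realType) (m : nat) (w u rho : 'I_m -> R)
    (o : pred 'I_m) (alpha g C theta M : R) :
  let eps := \sum_(i | o i) w i in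
  (forall i, 0 <= w i) -> \sum_i w i = 1 ->
  0 <= theta <= 2^-1 -> theta * C = g ^+ 2 / 2 ->
  (forall i, ~~ o i -> rho i ^+ 2 <= C * eps) ->
  (forall i, o i -> g ^+ 2 <= rho i ^+ 2) ->
  (forall i, u i ^+ 2 <= M) ->
  theta / 2 * \sum_i w i * u i ^+ 2 - 2 * M * eps <=
    \sum_i w i * (u i - alpha * rho i) ^+ 2.
Proof.
move=> eps w0 w1 /andP[t0 t1] tC rhoC rhog uM.
have eps0 : 0 <= eps by apply: sumr_ge0.
pose a2 := alpha ^+ 2; have a20 : 0 <= a2 by exact: sqr_ge0.
pose K := a2 * g ^+ 2 / 2.
have K0 : 0 <= K by rewrite /K divr_ge0// mulr_ge0// sqr_ge0.
have H i : theta / 2 * (w i * u i ^+ 2) - 2 * M * (if o i then w i else 0)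
      + K * (if o i then w i else 0) - K * eps * w i <=
    w i * (u i - alpha * rho i) ^+ 2.
  have u20 := sqr_ge0 (u i).
  have Kw : 0 <= K * eps by rewrite mulr_ge0.
  case: ifPn => oi; last first.
    rewrite !mulr0 subr0 addr0.
    have -> : theta / 2 * (w i * u i ^+ 2) - K * eps * w i =
      w i * (theta / 2 * u i ^+ 2 - K * eps) by ring.
    apply: ler_wpM2l => //.
    have h1 : theta * u i ^+ 2 / 2 - theta * (a2 * rho i ^+ 2) <=
        theta * (u i - alpha * rho i) ^+ 2.
      have -> : theta * u i ^+ 2 / 2 - theta * (a2 * rho i ^+ 2) =
        theta * (u i ^+ 2 / 2 - a2 * rho i ^+ 2) by ring.
      apply: ler_wpM2l => //.
      by have := sqr_ge0 (u i - 2 * (alpha * rho i)); rewrite /a2; nra.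
    have h2 : theta * (u i - alpha * rho i) ^+ 2 <= (u i - alpha * rho i) ^+ 2.
      by rewrite ler_piMl ?sqr_ge0//; lra.
    have h3 : theta * (a2 * rho i ^+ 2) <= K * eps.
      have -> : K * eps = theta * (a2 * (C * eps)).
        by rewrite /K; transitivity (a2 * (theta * C) * eps); [rewrite tC; ring|ring].
      by rewrite !ler_wpM2l// rhoC.
    lra.
  have -> : theta / 2 * (w i * u i ^+ 2) - 2 * M * w i + K * w i - K * eps * w i =
    w i * (theta / 2 * u i ^+ 2 - 2 * M + K - K * eps) by ring.
  apply: ler_wpM2l => //.
  have h1 : a2 * rho i ^+ 2 / 2 - u i ^+ 2 <= (u i - alpha * rho i) ^+ 2.
    by have := sqr_ge0 (2 * u i - alpha * rho i); rewrite /a2; nra.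
  have h2 : K <= a2 * rho i ^+ 2 / 2.
    by rewrite /K ler_wpM2r// ler_wpM2l// rhog.
  have h3 : theta / 2 * u i ^+ 2 <= u i ^+ 2 by rewrite ler_piMl//; lra.
  have := uM i; lra.
have : \sum_i (theta / 2 * (w i * u i ^+ 2) - 2 * M * (if o i then w i else 0)
      + K * (if o i then w i else 0) - K * eps * w i) <=
    \sum_i w i * (u i - alpha * rho i) ^+ 2 by apply: ler_sum => i _; exact: H.
apply: le_trans; rewrite !big_split /= !sumrN -!mulr_sumr w1 -!big_mkcond/= -/eps mulr1.
lra.
Qed.

(** w i = w k exp (- mu (t i - t k)) with w k <= 1, and x exp (- x) <= 1. *)
Lemma gibbs_decay (R : realType) (m : nat) (w t : 'I_m -> R) (nu mu : R) :
  (forall i, 0 < w i) -> \sum_i w i = 1 ->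
  (forall i, ln (w i) + nu + mu * t i = 0) ->
  forall i k, w i * (mu * (t i - t k)) <= 1.
Proof.
move=> w0 w1 wt i k; set d := mu * (t i - t k).
have wk1 : w k <= 1.
  by rewrite -w1 (bigD1 k)//= lerDl sumr_ge0// => j _; exact: ltW.
have wi : w i * expR d = w k.
  have lnKw j : expR (ln (w j)) = w j by apply: lnK; rewrite posrE.
  rewrite -(lnKw i) -expRD -(lnKw k); congr expR.
  by have := wt i; have := wt k; rewrite /d; lra.
apply: le_trans wk1; rewrite -wi ler_pM2l//.
by have := expR_ge1Dx d; lra.
Qed.

(** Chebyshev: w i - 1/m and ln (w i) - ln (1/m) have the same sign, and
    ln (w i) is affine in t i with slope - mu. *)
Lemma gibbs_mean (R : realType) (m : nat) (w t : 'I_m -> R) (nu mu : R) :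
  (forall i, 0 < w i) -> \sum_i w i = 1 ->
  (forall i, ln (w i) + nu + mu * t i = 0) ->
  0 <= mu * (m%:R^-1 * \sum_i t i - \sum_i w i * t i).
Proof.
move=> w0 w1 wt; set p := m%:R^-1.
have m0 : (0 < m)%N.
  by case: m w t w0 w1 wt @p => // w t _ /eqP; rewrite big_ord0 eq_sym oner_eq0.
have p0 : 0 < p by rewrite invr_gt0 ltr0n.
have p1 : \sum_(i < m) p = 1.
  by rewrite sumr_const card_ord -mulr_natl mulfV// pnatr_eq0 -lt0n.
have : 0 <= \sum_i (w i - p) * (ln (w i) - ln p).
  apply: sumr_ge0 => i _; have [wp|pw] := leP (w i) p.
    by rewrite mulr_le0// subr_le0// ler_ln ?posrE.
  by rewrite mulr_ge0// subr_ge0 ?(ltW pw)// ler_ln ?posrE ?ltW.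
have -> : \sum_i (w i - p) * (ln (w i) - ln p) =
    \sum_i ((w i - p) * (- nu - ln p) + mu * (p * t i - w i * t i)).
  apply: eq_bigr => i _; have -> : ln (w i) = - nu - mu * t i.
    by have := wt i; lra.
  ring.
rewrite big_split/= -mulr_suml sumrB w1 p1 subrr mul0r add0r.
by rewrite -mulr_sumr sumrB -mulr_sumr.
Qed.

(** * Equilibria: the zeros of F *)

Section equilibria.
Context {R : realType} {m n : nat}.
Variables (A : 'M[R]_(m, n)) (b : 'cV[R]_m).
Implicit Types (y : @state R m n) (z : 'cV[R]_n).

Lemma delta_imuE : delta_mx 0 imu = mk_state 0 1 0 0 :> @state R m n.
Proof.
by apply/rowP; apply: state_index_ind => [||i|j];
  rewrite mk_stateE mxE eqxx //= mxE.
Qed.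

(** With w > 0, F vanishes at (y; E) exactly when its value at parameter 0 is
    E e_2. *)
Definition equilibrium (E : R) y :=
  (forall i, 0 < w_of y i 0) /\ F A b 0 y = E *: mk_state 0 1 0 0.

Lemma F_eqP y (l mu : R) (w : 'cV[R]_m) (x : 'cV[R]_n) :
  F A b 0 y = mk_state l mu w x ->
  [/\ \sum_i w_of y i 0 - 1 = l,
      \sum_i w_of y i 0 * res_of A b y i 0 ^+ 2 = mu,
      forall i, ln (w_of y i 0) + (1 + lam_of y)
                + mu_of y * res_of A b y i 0 ^+ 2 = w i 0 &
      forall j, \sum_i A i j * (w_of y i 0 * res_of A b y i 0) = x j 0].
Proof.
move=> Fy; split => [||i|j].
- by move: (congr1 (fun s : 'rV[R]_(2 + m + n) => s 0 ilam) Fy); rewrite !mk_stateE.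
- move: (congr1 (fun s : 'rV[R]_(2 + m + n) => s 0 imu) Fy).
  by rewrite !mk_stateE F2E subr0.
- move: (congr1 (fun s : 'rV[R]_(2 + m + n) => s 0 (iw i)) Fy).
  by rewrite !mk_stateE F3E.
- move: (congr1 (fun s : 'rV[R]_(2 + m + n) => s 0 (ix j)) Fy).
  by rewrite !mk_stateE F4E.
Qed.

Lemma scale_mk_state (c : R) :
  c *: mk_state 0 1 0 0 = mk_state 0 c 0 0 :> @state R m n.
Proof.
apply/rowP; apply: state_index_ind => [||i|j]; rewrite [LHS]mxE !mk_stateE.
- by rewrite mulr0.
- by rewrite mulr1.
- by rewrite !mxE mulr0.
- by rewrite !mxE mulr0.
Qed.

Section at_equilibrium.
Variables (E : R) (y : @state R m n).
Hypothesis eqy : equilibrium E y.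

Lemma equilibrium_w_gt0 i : 0 < w_of y i 0.
Proof. exact: eqy.1. Qed.

Lemma equilibrium_mass : \sum_i w_of y i 0 = 1.
Proof.
have [/eqP + _ _ _] := F_eqP (etrans eqy.2 (scale_mk_state E)).
by rewrite subr_eq0 => /eqP.
Qed.

Lemma equilibrium_energy : \sum_i w_of y i 0 * res_of A b y i 0 ^+ 2 = E.
Proof. by have [] := F_eqP (etrans eqy.2 (scale_mk_state E)). Qed.

Lemma equilibrium_gibbs i :
  ln (w_of y i 0) + (1 + lam_of y) + mu_of y * res_of A b y i 0 ^+ 2 = 0.
Proof.
by have [_ _ H _] := F_eqP (etrans eqy.2 (scale_mk_state E)); rewrite (H i) mxE.
Qed.

Lemma equilibrium_normal j : \sum_i A i j * (w_of y i 0 * res_of A b y i 0) = 0.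
Proof.
by have [_ _ _ H] := F_eqP (etrans eqy.2 (scale_mk_state E)); rewrite (H j) mxE.
Qed.

Lemma equilibrium_orth z : \sum_i w_of y i 0 * (res_of A b y i 0 * (A *m z) i 0) = 0.
Proof.
under eq_bigr do rewrite [(A *m z) _ _]mxE mulr_sumr mulr_sumr.
rewrite exchange_big /= big1// => j _.
transitivity ((\sum_i A i j * (w_of y i 0 * res_of A b y i 0)) * z j 0).
  by rewrite mulr_suml; apply: eq_bigr => i _; ring.
by rewrite equilibrium_normal mul0r.
Qed.

Lemma equilibrium_w_le1 i : w_of y i 0 <= 1.
Proof.
rewrite -equilibrium_mass (bigD1 i)//= lerDl sumr_ge0// => j _.
by rewrite ltW// equilibrium_w_gt0.
Qed.

End at_equilibrium.

Lemma weighted_gram y z : (z^T *m (A^T *m W_of y *m A) *m z) 0 0 =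
  \sum_i w_of y i 0 * (A *m z) i 0 ^+ 2.
Proof.
have -> : z^T *m (A^T *m W_of y *m A) *m z = (A *m z)^T *m (W_of y *m (A *m z)).
  by rewrite trmx_mul !mulmxA.
rewrite mxE; apply: eq_bigr => i _.
by rewrite /W_of mul_diag_mx !mxE; ring.
Qed.

Lemma norm_sqr_le_sum z : `|z| ^+ 2 <= \sum_j z j 0 ^+ 2.
Proof.
have s0 : 0 <= \sum_j z j 0 ^+ 2 by apply: sumr_ge0 => j _; exact: sqr_ge0.
suff : `|z| <= Num.sqrt (\sum_j z j 0 ^+ 2).
  by move=> H; rewrite -[leRHS]sqr_sqrtr// lerXn2r ?nnegrE ?sqrtr_ge0.
apply: mx_norm_le => [|i j]; first exact: sqrtr_ge0.
rewrite ord1 -sqrtr_sqr ler_wsqrtr// (bigD1 i)//= lerDl.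
by apply: sumr_ge0 => k _; exact: sqr_ge0.
Qed.

Lemma mulmx_coord_le z i : `|(A *m z) i 0| <= n%:R * `|A| * `|z|.
Proof.
by rewrite -mulrA; apply: le_trans (norm_mulmx_le _ _); exact: mx_coord_le.
Qed.

Lemma loewner_sum y (s : R) z : loewner_ge (A^T *m W_of y *m A) s ->
  s * \sum_j z j 0 ^+ 2 <= \sum_i w_of y i 0 * (A *m z) i 0 ^+ 2.
Proof. by move=> /(_ z); rewrite weighted_gram. Qed.

Lemma res_subE y (xb : 'cV[R]_n) i :
  res_of A b y i 0 - (A *m xb - b) i 0 = (A *m (x_of y - xb)) i 0.
Proof. by rewrite mulmxBr /res_of; rewrite !mxE; ring. Qed.

(** Minimising over alpha projects r (A z) onto the orthogonal complement of
    r^2 - E in L^2(w); it is already orthogonal to 1 by the normal equations. *)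
Definition second_order (E : R) y :=
  forall z, exists alpha, 2 * mu_of y *
    \sum_i w_of y i 0 * (res_of A b y i 0 * (A *m z) i 0
                         - alpha * (res_of A b y i 0 ^+ 2 - E)) ^+ 2 <=
    \sum_i w_of y i 0 * (A *m z) i 0 ^+ 2.

End equilibria.

(** * The multiplier cannot blow up *)

Lemma finite_gap (R : realType) (m : nat) (f : 'I_m -> R) :
  exists2 g : R, 0 < g & forall j, 0 < f j -> g <= f j.
Proof.
exists (\big[Num.min/1]_(j | 0 < f j) f j).
  by elim/big_ind : _ => // x y x0 y0; rewrite lt_min x0.
by move=> j fj; exact: bigmin_le_cond.
Qed.

Section no_blow_up.
Context {R : realType} {m n : nat}.
Variables (A : 'M[R]_(m, n)) (b : 'cV[R]_m) (c s0 : R) (xb : 'cV[R]_n).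
Hypotheses (n0 : (0 < n)%N) (c0 : 0 < c) (s00 : 0 < s0).

Let rb i : R := (A *m xb - b) i 0.
(** NA bounds the operator A, and K bounds the residuals at all points within
    distance 1 of xb. *)
Let NA := n%:R * `|A| + 1.
Let K := \sum_i `|rb i| + NA.

Let NA0 : 0 < NA. Proof. by rewrite /NA ltr_wpDl// mulr_ge0. Qed.

Let K0 : 0 < K. Proof. by rewrite /K ltr_wpDl// sumr_ge0. Qed.

Let A_le (z : 'cV[R]_n) i : `|(A *m z) i 0| <= NA * `|z|.
Proof.
apply: le_trans (mulmx_coord_le _ _ _) _; rewrite ler_wpM2r// /NA; lra.
Qed.

Section near_xb.
Variables (d E : R) (y : @state R m n).
Hypotheses (d0 : 0 < d) (d1 : d <= 1) (cE : c < E) (eqy : equilibrium A b E y).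
Hypotheses (mud : 1 < d * mu_of y) (xd : `|x_of y - xb| < d).

Let w i : R := w_of y i 0.
Let r i : R := res_of A b y i 0.

Let w0 i : 0 < w i. Proof. exact: equilibrium_w_gt0 eqy i. Qed.

Let r_rb i : `|r i - rb i| <= NA * `|x_of y - xb|.
Proof. by rewrite /r /rb res_subE. Qed.

Let rK i : `|r i| <= K /\ `|rb i| <= K.
Proof.
have rbi : `|rb i| <= \sum_i `|rb i|.
  by rewrite (bigD1 i)//= lerDl sumr_ge0.
have : `|r i| <= `|rb i| + `|r i - rb i|.
  by have := ler_normD (rb i) (r i - rb i); rewrite addrC subrK.
have := r_rb i; have : NA * `|x_of y - xb| <= NA * 1.
  by rewrite ler_pM2l// ltW// (lt_le_trans xd).
by have := NA0; rewrite /K => *; split; lra.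
Qed.

Let r2_rb i : `|r i ^+ 2 - rb i ^+ 2| <= 2 * K * NA * d.
Proof.
have [rK1 rK2] := rK i.
have -> : r i ^+ 2 - rb i ^+ 2 = (r i + rb i) * (r i - rb i) by ring.
rewrite normrM -mulrA; apply: ler_pM => //.
  by apply: le_trans (ler_normD _ _) _; lra.
by apply: le_trans (r_rb i) _; rewrite ler_pM2l// ltW.
Qed.

Let mu0 : 0 < mu_of y.
Proof. by rewrite -(pmulr_rgt0 _ d0) (lt_trans ltr01). Qed.

Let decay i k : w i * (mu_of y * (r i ^+ 2 - r k ^+ 2)) <= 1.
Proof.
exact: (gibbs_decay (equilibrium_w_gt0 eqy) (equilibrium_mass eqy)
  (equilibrium_gibbs eqy)).
Qed.

(** E - r_k^2 is the w-mean of r_i^2 - r_k^2, and each term of it is at most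
    1 / mu < d: the smallest squared residual is almost E. *)
Let r2_ge k : E - m%:R * d <= r k ^+ 2.
Proof.
have : mu_of y * (E - r k ^+ 2) <= m%:R.
  have -> : mu_of y * (E - r k ^+ 2) =
      \sum_i w i * (mu_of y * (r i ^+ 2 - r k ^+ 2)).
    transitivity (mu_of y * (\sum_i w i * r i ^+ 2 - \sum_i w i * r k ^+ 2)).
      by rewrite (equilibrium_energy eqy) -mulr_suml (equilibrium_mass eqy) mul1r.
    by rewrite -sumrB mulr_sumr; apply: eq_bigr => i _; ring.
  have -> : m%:R = \sum_(i < m) (1 : R) by rewrite sumr_const card_ord.
  by apply: ler_sum => i _; exact: decay.
move=> H; have [|Er] := leP (E - r k ^+ 2) 0.
  have : 0 <= m%:R * d by rewrite mulr_ge0// ltW.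
  by lra.
have : d * (mu_of y * (E - r k ^+ 2)) <= d * m%:R by rewrite ler_pM2l.
have : E - r k ^+ 2 <= d * mu_of y * (E - r k ^+ 2) by rewrite ler_peMl ?ltW.
lra.
Qed.

(** Letting d tend to 0 shows that no squared residual at xb is below c. *)
Lemma rb2_ge_near k : c - (m%:R + 2 * K * NA) * d <= rb k ^+ 2.
Proof.
by have := r2_ge k; have := r2_rb k; rewrite ler_norml mulrDl => /andP[]; move: cE; lra.
Qed.

Section with_gap.
Variable g : R.
Hypotheses (g0 : 0 < g) (rb2_ge : forall i, c <= rb i ^+ 2).
Hypothesis gapP : forall j, 0 < (rb j ^+ 2 - c) / 3 -> g <= (rb j ^+ 2 - c) / 3.
Hypotheses (Ed : E < c + d) (dg : d <= g) (dg2 : 2 * K * NA * d <= g).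
Hypothesis (dc : 2 * K * NA * d <= c / 2).
Hypothesis (coer : loewner_ge (A^T *m W_of y *m A) (s0 ^+ 2)).
Hypothesis (so : second_order A b E y).

(** The indices that lose their weight in the limit. *)
Let o : pred 'I_m := fun i => c < rb i ^+ 2.
Let eps := \sum_(i | o i) w i.
Let rho i : R := r i ^+ 2 - E.
Let C := 2 * K ^+ 2 + 8 * K ^+ 4 * NA ^+ 2 / s0 ^+ 2 + g ^+ 2.
Let theta := g ^+ 2 / (2 * C).

Let eps0 : 0 <= eps. Proof. by apply: sumr_ge0 => i _; exact: ltW. Qed.

Let rho_off i : o i -> g <= rho i.
Proof.
move=> oi; have : g <= (rb i ^+ 2 - c) / 3.
  by apply: gapP; rewrite divr_gt0// subr_gt0.
by move: Ed dg dg2 cE; rewrite /rho; have := r2_rb i; rewrite ler_norml => /andP[]; lra.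
Qed.

(** On the set o the gap forces r_i^2 - E >= g, and averaging the decay estimate
    over k gives w_i mu (r_i^2 - E) <= 1. *)
Let eps_le : eps <= m%:R * (d / g).
Proof.
have wi i : o i -> w i <= d / g.
  move=> /rho_off rg.
  have : w i * (mu_of y * rho i) <= 1.
    have -> : w i * (mu_of y * rho i) =
        \sum_k w k * (w i * (mu_of y * (r i ^+ 2 - r k ^+ 2))).
      transitivity (w i * mu_of y * (r i ^+ 2 * \sum_k w k - \sum_k w k * r k ^+ 2)).
        by rewrite (equilibrium_energy eqy) (equilibrium_mass eqy) mulr1 -mulrA.
      by rewrite mulr_sumr -sumrB mulr_sumr; apply: eq_bigr => k _; ring.
    rewrite -[leRHS](equilibrium_mass eqy); apply: ler_sum => k _.
    by rewrite ler_piMr// ltW.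
  move=> H; rewrite ler_pdivlMr//.
  have h1 : w i * g <= w i * rho i by rewrite ler_pM2l.
  have h2 : d * (w i * (mu_of y * rho i)) <= d * 1 by rewrite ler_pM2l.
  have h3 : w i * rho i <= (d * mu_of y) * (w i * rho i).
    by rewrite ler_peMl ?ltW// mulr_gt0// (lt_le_trans g0).
  lra.
have -> : m%:R * (d / g) = \sum_(i < m) (d / g).
  by rewrite sumr_const card_ord -[RHS]mulr_natl.
rewrite /eps big_mkcond; apply: ler_sum => i _.
by case: ifP => [/wi//|_]; rewrite divr_ge0// ltW.
Qed.

Let Delta := x_of y - xb.

(** The w-energy at xb exceeds E by the squared w-norm of A (x - xb), as x
    minimises the w-energy; and it exceeds c by K^2 eps at most, since the
    squared residuals at xb equal c outside o. *)
Let energy_gap : E - c + s0 ^+ 2 * `|Delta| ^+ 2 <= K ^+ 2 * eps.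
Proof.
have h1 : \sum_i w i * rb i ^+ 2 = E + \sum_i w i * (A *m Delta) i 0 ^+ 2.
  have -> : E = \sum_i w i * r i ^+ 2 - 2 * \sum_i w i * (r i * (A *m Delta) i 0).
    by rewrite (equilibrium_orth eqy) mulr0 subr0 (equilibrium_energy eqy).
  rewrite mulr_sumr -sumrB -big_split /=; apply: eq_bigr => i _.
  have -> : rb i = r i - (A *m Delta) i 0.
    by rewrite -(res_subE A b) -/(r i) -/(rb i); ring.
  ring.
have h2 : \sum_i w i * rb i ^+ 2 <= c + K ^+ 2 * eps.
  have -> : c + K ^+ 2 * eps = \sum_i (w i * c + K ^+ 2 * (if o i then w i else 0)).
    rewrite big_split /= -mulr_suml (equilibrium_mass eqy) mul1r -mulr_sumr.
    by rewrite -big_mkcond.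
  apply: ler_sum => i _; case: ifPn => [oi|].
    rewrite -[leLHS]add0r lerD//; first by rewrite mulr_ge0// ltW.
    rewrite mulrC ler_pM2r// -[rb i ^+ 2]real_normK ?num_real//.
    by rewrite lerXn2r ?nnegrE// ?(ltW K0)//; case: (rK i).
  by rewrite /o -leNgt mulr0 addr0 => H; rewrite ler_pM2l.
have h3 := loewner_sum Delta coer.
have h4 : s0 ^+ 2 * `|Delta| ^+ 2 <= s0 ^+ 2 * \sum_j Delta j 0 ^+ 2.
  by rewrite ler_pM2l ?exprn_gt0// norm_sqr_le_sum.
move: h3; rewrite -/w; lra.
Qed.

(** Outside o, r^2 - E is a difference of two quantities controlled by the
    energy gap: r^2 - rb^2, of order |x - xb|, and E - c. *)
Let rho_on i : ~~ o i -> rho i ^+ 2 <= C * eps.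
Proof.
rewrite /o -leNgt => rbc; have {rbc}rbc : rb i ^+ 2 = c.
  by apply/eqP; rewrite eq_le rbc rb2_ge.
have [rK1 rK2] := rK i.
have s20 : 0 < s0 ^+ 2 by rewrite exprn_gt0.
have D2 : `|Delta| ^+ 2 <= K ^+ 2 * eps / s0 ^+ 2.
  by rewrite ler_pdivlMr// mulrC; move: cE energy_gap; lra.
have Ec : E - c <= K ^+ 2 * eps.
  have := energy_gap; have : 0 <= s0 ^+ 2 * `|Delta| ^+ 2.
    by rewrite mulr_ge0 ?sqr_ge0.
  lra.
have h1 : (r i ^+ 2 - rb i ^+ 2) ^+ 2 <= (2 * K) ^+ 2 * (NA ^+ 2 * `|Delta| ^+ 2).
  have -> : r i ^+ 2 - rb i ^+ 2 = (r i + rb i) * (r i - rb i) by ring.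
  rewrite exprMn -[NA ^+ 2 * _]exprMn.
  rewrite -[X in X * _ <= _]real_normK ?num_real//.
  rewrite -[X in _ * X <= _]real_normK ?num_real//.
  apply: ler_pM; rewrite ?sqr_ge0//.
    rewrite lerXn2r ?nnegrE ?mulr_ge0 ?(ltW K0)//.
    by apply: le_trans (ler_normD _ _) _; lra.
  rewrite lerXn2r ?nnegrE ?mulr_ge0 ?(ltW NA0)//; exact: r_rb.
have h2 : (E - c) ^+ 2 <= K ^+ 2 * eps.
  apply: le_trans Ec; rewrite expr2 ler_piMr//; move: cE Ed d1; lra.
have h3 : rho i ^+ 2 <= 2 * (r i ^+ 2 - rb i ^+ 2) ^+ 2 + 2 * (E - c) ^+ 2.
  have -> : rho i = (r i ^+ 2 - rb i ^+ 2) - (E - c) by rewrite /rho rbc; ring.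
  have := sqr_ge0 ((r i ^+ 2 - rb i ^+ 2) + (E - c)); nra.
have h4 : (2 * K) ^+ 2 * (NA ^+ 2 * `|Delta| ^+ 2) <=
    (2 * K) ^+ 2 * (NA ^+ 2 * (K ^+ 2 * eps / s0 ^+ 2)).
  by rewrite ler_wpM2l ?sqr_ge0// ler_wpM2l ?sqr_ge0.
have -> : C * eps = 2 * ((2 * K) ^+ 2 * (NA ^+ 2 * (K ^+ 2 * eps / s0 ^+ 2)))
    + 2 * (K ^+ 2 * eps) + g ^+ 2 * eps by rewrite /C; ring.
have : 0 <= g ^+ 2 * eps by rewrite mulr_ge0 ?sqr_ge0.
lra.
Qed.

(** Apply the concentration estimate with u = r (A z) for a unit vector z: the
    second-order condition and mu > 1 / d bound the right-hand side by a
    multiple of d, whereas u has squared w-norm at least c s0^2 / 2. *)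
Lemma second_order_bound :
  theta * c * s0 ^+ 2 / 4 <= d * (NA ^+ 2 / 2 + 2 * (K ^+ 2 * NA ^+ 2) * m%:R / g).
Proof.
have g20 : 0 < g ^+ 2 by rewrite exprn_gt0.
have C0 : g ^+ 2 <= C.
  rewrite /C lerDr addr_ge0 ?mulr_ge0 ?sqr_ge0 ?invr_ge0 ?exprn_ge0// ltW//.
have C00 : 0 < C by exact: lt_le_trans C0.
have th0 : 0 <= theta by rewrite /theta divr_ge0 ?mulr_ge0 ?ltW.
have th1 : theta <= 2^-1.
  by rewrite /theta invfM mulrA mulrAC ler_piMl// ler_pdivrMr// mul1r.
have thC : theta * C = g ^+ 2 / 2.
  by rewrite /theta; field; rewrite gt_eqF.
pose z : 'cV[R]_n := delta_mx (Ordinal n0) 0.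
have z1 : \sum_j z j 0 ^+ 2 = 1.
  rewrite (bigD1 (Ordinal n0))//= big1 => [|j jn0].
    by rewrite /z mxE !eqxx expr1n addr0.
  by rewrite /z mxE (negbTE jn0) expr0n.
have zn : `|z| <= 1.
  by have := norm_sqr_le_sum z; rewrite z1 expr_le1.
pose h i : R := (A *m z) i 0.
have hN i : h i ^+ 2 <= NA ^+ 2.
  rewrite -[leLHS]real_normK ?num_real// lerXn2r ?nnegrE ?(ltW NA0)//.
  by apply: le_trans (A_le _ _) _; rewrite ler_piMr// ltW.
pose u i : R := r i * h i.
have uM i : u i ^+ 2 <= K ^+ 2 * NA ^+ 2.
  rewrite exprMn ler_pM ?sqr_ge0// -[leLHS]real_normK ?num_real//.
  by rewrite lerXn2r ?nnegrE ?(ltW K0)//; case: (rK i).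
have [alpha] := so z; rewrite -/w -/r -/h.
have : \sum_i w i * h i ^+ 2 <= NA ^+ 2.
  rewrite -[leRHS]mul1r -(equilibrium_mass eqy) mulr_suml.
  by apply: ler_sum => i _; rewrite ler_pM2l.
have coz : s0 ^+ 2 <= \sum_i w i * h i ^+ 2.
  by have := loewner_sum z coer; rewrite z1 mulr1.
have uc : c / 2 * s0 ^+ 2 <= \sum_i w i * u i ^+ 2.
  have : c / 2 * s0 ^+ 2 <= c / 2 * \sum_i w i * h i ^+ 2.
    by rewrite ler_wpM2l// divr_ge0// ltW.
  move=> /le_trans; apply; rewrite mulr_sumr; apply: ler_sum => i _.
  rewrite mulrCA ler_pM2l// exprMn ler_wpM2r ?sqr_ge0//.
  by move: dc (rb2_ge i) (r2_rb i); rewrite ler_norml => H1 H2 /andP[]; lra.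
have th01 : 0 <= theta <= 2^-1 by rewrite th0.
have rho2 i : o i -> g ^+ 2 <= rho i ^+ 2.
  by move=> /rho_off gr; rewrite lerXn2r ?nnegrE ?(ltW g0)//; move: g0 gr; lra.
have := concentration_estimate alpha (fun i => ltW (w0 i))
  (equilibrium_mass eqy) th01 thC rho_on rho2 uM.
rewrite -/eps; set S := \sum_i w i * (u i - alpha * rho i) ^+ 2 => HS hN2.
rewrite -/S => so1.
have S0 : 0 <= S by apply: sumr_ge0 => i _; rewrite mulr_ge0 ?sqr_ge0// ltW.
have SN : 2 * S <= d * NA ^+ 2.
  have : d * (2 * mu_of y * S) <= d * NA ^+ 2.
    by rewrite ler_pM2l//; apply: le_trans hN2.
  have : S <= d * mu_of y * S by rewrite ler_peMl// ltW.
  lra.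
have uc' : theta / 2 * (c / 2 * s0 ^+ 2) <= theta / 2 * \sum_i w i * u i ^+ 2.
  by rewrite ler_wpM2l// divr_ge0.
have : 2 * (K ^+ 2 * NA ^+ 2) * eps <= 2 * (K ^+ 2 * NA ^+ 2) * (m%:R * (d / g)).
  by rewrite ler_wpM2l// mulr_ge0// mulr_ge0 ?sqr_ge0.
lra.
Qed.

End with_gap.
End near_xb.

(** For small d the bound of [second_order_bound] fails, its left-hand side being
    independent of d. *)
Lemma multiplier_no_blow_up :
  ~ (forall d, 0 < d -> exists E y, [/\ c < E < c + d, equilibrium A b E y,
       loewner_ge (A^T *m W_of y *m A) (s0 ^+ 2), second_order A b E y &
       1 < d * mu_of y /\ `|x_of y - xb| < d]).
Proof.
move=> H.
have KN0 : 0 < 2 * K * NA by rewrite !mulr_gt0.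
have rb2_ge k : c <= rb k ^+ 2.
  rewrite leNgt; apply/negP => rbc.
  pose L := m%:R + 2 * K * NA.
  have L0 : 0 < L by rewrite ltr_wpDl.
  pose d := Num.min 1 ((c - rb k ^+ 2) / (2 * L)).
  have d0 : 0 < d by rewrite lt_min ltr01 divr_gt0 ?subr_gt0 ?mulr_gt0.
  have d1 : d <= 1 by rewrite ge_min lexx.
  have dL : d * (2 * L) <= c - rb k ^+ 2.
    by rewrite -ler_pdivlMr ?mulr_gt0// ge_min lexx orbT.
  have [E [y [/andP[cE _] eqy _ _ [mud xd]]]] := H _ d0.
  have := rb2_ge_near d0 d1 cE eqy mud xd k; rewrite -/L; lra.
(* One third of the gap absorbs r^2 - rb^2, another E - c, and g is left. *)
have [g g0 gapP] := finite_gap (fun j => (rb j ^+ 2 - c) / 3).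
pose C := 2 * K ^+ 2 + 8 * K ^+ 4 * NA ^+ 2 / s0 ^+ 2 + g ^+ 2.
pose theta := g ^+ 2 / (2 * C).
pose B := NA ^+ 2 / 2 + 2 * (K ^+ 2 * NA ^+ 2) * m%:R / g.
have C0 : 0 < C.
  by rewrite /C ltr_wpDl ?exprn_gt0// addr_ge0 ?mulr_ge0 ?sqr_ge0 ?invr_ge0
    ?exprn_ge0// ltW.
have t0 : 0 < theta * c * s0 ^+ 2 / 4.
  by rewrite divr_gt0// mulr_gt0 ?exprn_gt0// mulr_gt0// divr_gt0 ?exprn_gt0// mulr_gt0.
have B0 : 0 < B.
  rewrite /B ltr_pwDl//; first by rewrite divr_gt0// exprn_gt0.
  by rewrite divr_ge0 ?(ltW g0)// mulr_ge0// mulr_ge0// mulr_ge0 ?sqr_ge0.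
have : \forall d \near (0 : R)^'+, [/\ d <= 1, d <= g, 2 * K * NA * d <= g,
    2 * K * NA * d <= c / 2 & d * B < theta * c * s0 ^+ 2 / 4].
  near=> d; split.
  - by near: d; apply: nbhs_right_le.
  - by near: d; apply: nbhs_right_le.
  - rewrite mulrC -ler_pdivlMr//; near: d; apply: nbhs_right_le; exact: divr_gt0.
  - rewrite mulrC -ler_pdivlMr//; near: d; apply: nbhs_right_le.
    by rewrite divr_gt0// divr_gt0.
  - rewrite -ltr_pdivlMr//; near: d; apply: nbhs_right_lt; exact: divr_gt0.
move=> near_d.
have [d [d0 [d1 dg dg2 dc dB]]] := filter_ex (filterI (nbhs_right_gt 0) near_d).
have [E [y [/andP[cE Ed] eqy coer so [mud xd]]]] := H _ d0.
have := second_order_bound d0 d1 cE eqy mud xd g0 rb2_ge gapP Ed dg dg2 dc coer so.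
by rewrite -/B -/C -/theta leNgt dB.
Unshelve. all: by end_near. Qed.

End no_blow_up.

(** * Least squares and the starting point *)

Section least_squares.
Context {R : realType} {m n : nat}.
Variables (A : 'M[R]_(m, n)) (b : 'cV[R]_m).
Hypothesis rankA : \rank A = n.

(** A vector v with v A^T A = 0 satisfies |v A^T|^2 = 0. *)
Lemma gram_unitmx : A^T *m A \in unitmx.
Proof.
have freeAT : row_free A^T by rewrite /row_free mxrank_tr rankA.
rewrite -row_free_unit -kermx_eq0; apply/eqP/row_matrixP => i; rewrite row0.
set v := row i _.
have v0 : v *m (A^T *m A) = 0 by rewrite /v -row_mul mulmx_ker row0.
apply/eqP; rewrite -(mulmx_free_eq0 _ freeAT); apply/eqP.
have : (v *m A^T) *m (v *m A^T)^T = 0.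
  by rewrite trmx_mul trmxK -mulmxA [A^T *m _]mulmxA mulmxA v0 mul0mx.
move: (v *m A^T) => u /matrixP/(_ 0 0); rewrite mxE [RHS]mxE => uu0.
apply/rowP => j; rewrite mxE; apply/eqP; rewrite -sqrf_eq0; apply/eqP.
have : \sum_k u 0 k ^+ 2 = 0.
  by rewrite -[RHS]uu0; apply: eq_bigr => k _; rewrite mxE expr2.
move=> /eqP; rewrite psumr_eq0 => [/allP/(_ j)|k _]; last exact: sqr_ge0.
by rewrite mem_index_enum => /(_ isT)/eqP.
Qed.

Lemma ls_normal : A^T *m ls_residual A b = 0.
Proof.
rewrite /ls_residual /ls_solution mulmxBr !mulmxA mulmxV ?gram_unitmx//.
by rewrite mul1mx subrr.
Qed.

Lemma normal_unique (x : 'cV[R]_n) :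
  A^T *m (A *m x - b) = 0 -> x = ls_solution A b.
Proof.
rewrite mulmxBr mulmxA => /eqP; rewrite subr_eq0 => /eqP Ax.
by rewrite /ls_solution -mulmxA -Ax mulKmx// gram_unitmx.
Qed.

Lemma ls_residual_min (x : 'cV[R]_n) :
  \sum_i ls_residual A b i 0 ^+ 2 <= \sum_i (A *m x - b) i 0 ^+ 2.
Proof.
pose d := x - ls_solution A b; pose rs := ls_residual A b.
have -> : A *m x - b = rs + A *m d.
  rewrite /rs /ls_residual /d mulmxBr.
  move: (A *m x) (A *m _) => u v.
  by apply/matrixP => i j; rewrite !mxE; ring.
have orth : \sum_i rs i 0 * (A *m d) i 0 = 0.
  have : (rs^T *m (A *m d)) 0 0 = 0.
    rewrite mulmxA -[rs^T *m A]trmxK trmx_mul trmxK ls_normal.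
    by rewrite trmx0 mul0mx mxE.
  by rewrite mxE => rs0; rewrite -[RHS]rs0; apply: eq_bigr => i _; rewrite [rs^T _ _]mxE.
have -> : \sum_i (rs + A *m d) i 0 ^+ 2 =
    \sum_i rs i 0 ^+ 2 + 2 * (\sum_i rs i 0 * (A *m d) i 0)
      + \sum_i (A *m d) i 0 ^+ 2.
  rewrite mulr_sumr -!big_split /=; apply: eq_bigr => i _.
  by rewrite [(rs + _) i 0]mxE; ring.
by rewrite orth mulr0 addr0 lerDl sumr_ge0// => i _; exact: sqr_ge0.
Qed.

Lemma mk_state_of (l mu : R) (w : 'cV[R]_m) (x : 'cV[R]_n) :
  let s := mk_state l mu w x in
  [/\ lam_of s = l, mu_of s = mu, w_of s = w & x_of s = x].
Proof.
split; rewrite ?lam_ofE ?mu_ofE ?mk_stateE//.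
  by apply/matrixP => i j; rewrite ord1 w_ofE mk_stateE.
by apply/matrixP => i j; rewrite ord1 x_ofE mk_stateE.
Qed.

Lemma equilibrium_y_star : (0 < m)%N -> equilibrium A b (E_uw A b) (y_star A b).
Proof.
move=> m0.
have [l1 mu1 w1 x1] := mk_state_of (- (1 + ln (m%:R^-1 : R))) 0
  (const_mx m%:R^-1) (ls_solution A b).
rewrite -/(y_star A b) in l1 mu1 w1 x1.
have w1i i : w_of (y_star A b) i 0 = m%:R^-1 by rewrite w1 mxE.
have rE : res_of A b (y_star A b) = ls_residual A b by rewrite /res_of x1.
split; first by move=> i; rewrite w1i invr_gt0 ltr0n.
rewrite scale_mk_state /F; congr mk_state.
- rewrite F1E; under eq_bigr do rewrite w1i.
  by rewrite sumr_const card_ord -[X in X - _]mulr_natl mulfV ?subrr// pnatr_eq0 -lt0n.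
- rewrite F2E subr0 rE /E_uw mulr_sumr; apply: eq_bigr => i _.
  by rewrite w1i.
- apply/matrixP => i j; rewrite ord1 F3E w1i l1 mu1 [RHS]mxE; ring.
- apply/matrixP => i j; rewrite ord1 F4E [RHS]mxE.
  have : (A^T *m ls_residual A b) i 0 = 0 by rewrite ls_normal mxE.
  rewrite mxE => Ar; rewrite rE.
  transitivity (m%:R^-1 * \sum_k A^T i k * ls_residual A b k 0).
    by rewrite mulr_sumr; apply: eq_bigr => k _; rewrite w1i [A^T _ _]mxE; ring.
  by rewrite Ar mulr0.
Qed.

Section at_equilibrium.
Variables (E : R) (y : @state R m n).
Hypothesis eqy : equilibrium A b E y.

(** The uniform mean of r^2 is at least E_uw > E, as ls_solution minimises the
    unweighted energy; then apply [gibbs_mean]. *)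
Lemma equilibrium_mu_ge0 : E < E_uw A b -> 0 <= mu_of y.
Proof.
move=> EE; have := gibbs_mean eqy.1 (equilibrium_mass eqy) (equilibrium_gibbs eqy).
rewrite (equilibrium_energy eqy) pmulr_lge0// subr_gt0.
apply: lt_le_trans EE _; rewrite /E_uw ler_wpM2l ?invr_ge0//.
exact: ls_residual_min.
Qed.

(** If r^2 were constant, the Gibbs weights would be uniform, so x would be the
    ordinary least squares solution, whose residual is not constant in modulus. *)
Lemma equilibrium_variance_gt0 :
  ~ (exists c : R, forall i, `|ls_residual A b i 0| = c) ->
  0 < \sum_i w_of y i 0 * (res_of A b y i 0 ^+ 2 - E) ^+ 2.
Proof.
move=> nc; have w0 := eqy.1.
have ge0 i : 0 <= w_of y i 0 * (res_of A b y i 0 ^+ 2 - E) ^+ 2.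
  by rewrite mulr_ge0 ?sqr_ge0// ltW.
rewrite lt0r sumr_ge0 ?andbT//; apply/negP; rewrite psumr_eq0// => /allP all0.
have rE i : res_of A b y i 0 ^+ 2 = E.
  have := all0 i; rewrite mem_index_enum mulf_eq0 gt_eqF//= sqrf_eq0 subr_eq0.
  by move=> /(_ isT)/eqP.
have wE : exists2 c : R, 0 < c & forall i, w_of y i 0 = c.
  exists (expR (- (1 + lam_of y) - mu_of y * E)); first exact: expR_gt0.
  move=> i; have := equilibrium_gibbs eqy i; rewrite rE => H.
  rewrite -[LHS](@lnK _ (w_of y i 0)) ?posrE//; congr expR; lra.
have [c c0 wc] := wE.
have xE : x_of y = ls_solution A b.
  apply: normal_unique; apply/matrixP => j k; rewrite ord1 mxE [RHS]mxE.
  apply/eqP; rewrite -(mulrI_eq0 _ (lregP (lt0r_neq0 c0))); apply/eqP.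
  rewrite mulr_sumr -[RHS](equilibrium_normal eqy j); apply: eq_bigr => i _.
  by rewrite [A^T _ _]mxE wc -/(res_of A b y); ring.
apply: nc; exists (Num.sqrt E) => i.
by rewrite -(rE i) sqrtr_sqr /res_of xE.
Qed.

End at_equilibrium.
End least_squares.

(** * The reduced Hessian *)

Section reduced_hessian.
Context {R : realType} {m n : nat}.
Variables (A : 'M[R]_(m, n)) (b : 'cV[R]_m).
Implicit Types (E : R) (y : @state R m n) (z : 'cV[R]_n).

Definition energy_dev E y i : R := res_of A b y i 0 ^+ 2 - E.

Definition energy_var E y : R := \sum_i w_of y i 0 * energy_dev E y i ^+ 2.

Definition energy_cov E y j : R :=
  \sum_i A i j * (w_of y i 0 * res_of A b y i 0 * energy_dev E y i).

(** The Schur complement of J obtained by eliminating lambda, mu and w.  Its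
    quadratic form is |A z|^2 - 2 mu |q|^2 in L^2(w), where q is the residual of
    the regression of r (A z) on 1 and r^2 - E. *)
Definition reduced_hessian E y : 'M[R]_n := \matrix_(j, k)
  (\sum_i A i j * A i k * w_of y i 0
   - 2 * mu_of y * (\sum_i A i j * A i k * (w_of y i 0 * res_of A b y i 0 ^+ 2)
                    - energy_cov E y j * energy_cov E y k / energy_var E y)).

(** The slope of the regression of r (A z) on r^2 - E in L^2(w). *)
Definition regression E y z : R :=
  (\sum_k energy_cov E y k * z k 0) / energy_var E y.

Lemma reduced_hessian_sym E y : (reduced_hessian E y)^T = reduced_hessian E y.
Proof.
apply/matrixP => j k; rewrite [LHS]mxE [LHS]mxE [RHS]mxE.
have sym (f : 'I_m -> R) : \sum_i A i k * A i j * f i = \sum_i A i j * A i k * f i.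
  by apply: eq_bigr => i _; ring.
by rewrite !sym; ring.
Qed.

Lemma mulmx_swap_sum z (f : 'I_m -> R) :
  \sum_k (\sum_i A i k * f i) * z k 0 = \sum_i f i * (A *m z) i 0.
Proof.
under eq_bigr do rewrite mulr_suml.
rewrite exchange_big /=; apply: eq_bigr => i _.
by rewrite mxE mulr_sumr; apply: eq_bigr => k _; ring.
Qed.

Lemma reduced_hessianE E y z j : (reduced_hessian E y *m z) j 0 =
  \sum_i A i j * (w_of y i 0 * (A *m z) i 0
    - 2 * mu_of y * (w_of y i 0 * res_of A b y i 0 *
       (res_of A b y i 0 * (A *m z) i 0 - regression E y z * energy_dev E y i))).
Proof.
rewrite mxE; set mu2 := 2 * mu_of y; set al := regression E y z.
have sw (f : 'I_m -> R) : \sum_k (\sum_i A i j * A i k * f i) * z k 0 =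
    \sum_i A i j * f i * (A *m z) i 0.
  rewrite -mulmx_swap_sum; apply: eq_bigr => k _; congr (_ * _).
  by apply: eq_bigr => i _; ring.
transitivity (\sum_k (\sum_i A i j * A i k * w_of y i 0) * z k 0
    - mu2 * (\sum_k (\sum_i A i j * A i k * (w_of y i 0 * res_of A b y i 0 ^+ 2)) * z k 0
             - energy_cov E y j * al)).
  have -> : energy_cov E y j * al =
      \sum_k (energy_cov E y j * energy_cov E y k / energy_var E y) * z k 0.
    by rewrite /al /regression mulr_suml mulr_sumr; apply: eq_bigr => k _; ring.
  rewrite -sumrB mulr_sumr -sumrB.
  by apply: eq_bigr => k _; rewrite mxE -/mu2; ring.
rewrite !sw /energy_cov mulr_suml -sumrB mulr_sumr -sumrB.
by apply: eq_bigr => i _; ring.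
Qed.

Lemma bil_reduced_hessian E y z : energy_var E y != 0 ->
  bil (reduced_hessian E y) z z =
  \sum_i w_of y i 0 * (A *m z) i 0 ^+ 2 - 2 * mu_of y *
    \sum_i w_of y i 0 * (res_of A b y i 0 * (A *m z) i 0
                         - regression E y z * energy_dev E y i) ^+ 2.
Proof.
move=> var0; pose r i : R := res_of A b y i 0; pose h i : R := (A *m z) i 0.
pose w i : R := w_of y i 0; pose rho i : R := energy_dev E y i.
set al := regression E y z.
have cov : \sum_i w i * r i * rho i * h i = al * energy_var E y.
  rewrite /al /regression divfK//.
  exact: esym (mulmx_swap_sum z (fun i => w i * r i * rho i)).
have -> : bil (reduced_hessian E y) z z =
    \sum_i (w i * h i - 2 * mu_of y * (w i * r i * (r i * h i - al * rho i))) * h i.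
  rewrite -mulmx_swap_sum /bil -mulmxA mxE; apply: eq_bigr => j _.
  by rewrite mxE mulrC reduced_hessianE.
have -> : \sum_i w i * (r i * h i - al * rho i) ^+ 2 =
    \sum_i w i * r i * (r i * h i - al * rho i) * h i.
  apply/eqP; rewrite -subr_eq0 -sumrB; apply/eqP.
  transitivity (al * (al * energy_var E y - \sum_i w i * r i * rho i * h i)).
    rewrite /energy_var mulr_sumr -sumrB mulr_sumr; apply: eq_bigr => i _.
    by rewrite -/(w i) -/(rho i); ring.
  by rewrite cov subrr mulr0.
rewrite mulr_sumr -sumrB; apply: eq_bigr => i _.
by rewrite -/(w i) -/(h i); ring.
Qed.

Lemma second_order_reduced_hessian E y : energy_var E y != 0 ->
  posdef (reduced_hessian E y) -> second_order A b E y.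
Proof.
move=> var0 pd z; exists (regression E y z).
rewrite -subr_ge0 -bil_reduced_hessian//.
have [->|/pd/ltW//] := eqVneq z 0.
by rewrite /bil mulmx0 mxE.
Qed.

(** A kernel vector z of the reduced Hessian lifts to a kernel vector of J by
    back substitution: mu and lambda move by - 2 mu times the regression
    coefficients of r (A z) on r^2 and 1, and w moves by - 2 mu w times the
    residual of the regression. *)
Lemma reduced_hessian_unitmx E y : equilibrium A b E y -> energy_var E y != 0 ->
  Jac A b y \in unitmx -> reduced_hessian E y \in unitmx.
Proof.
move=> eqy var0; rewrite /Jac unitmx_tr => uJ.
rewrite -unitmx_tr -row_free_unit -kermx_eq0; apply/eqP/row_matrixP => k; rewrite row0.
set v := row k _.
have : v *m (reduced_hessian E y)^T = 0 by rewrite /v -row_mul mulmx_ker row0.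
move: v => v /(congr1 trmx); rewrite trmx_mul trmxK trmx0.
set z := v^T => Sz0; rewrite -[v]trmxK -/z; clearbody z => {v}.
have w0 := eqy.1.
pose r i : R := res_of A b y i 0; pose h i : R := (A *m z) i 0.
pose w i : R := w_of y i 0; pose rho i : R := energy_dev E y i.
pose al := regression E y z; pose mu2 := 2 * mu_of y.
pose dw : 'cV[R]_m := \col_i (- (mu2 * (w i * (r i * h i - al * rho i)))).
pose s := mk_state (mu2 * al * E) (- (mu2 * al)) dw z.
have [ls ms ws xs] := mk_state_of (mu2 * al * E) (- (mu2 * al)) dw z.
rewrite -/s in ls ms ws xs.
have cov : \sum_i w i * (r i * h i * rho i) = al * energy_var E y.
  rewrite /al /regression divfK//.
  rewrite (mulmx_swap_sum z (fun i => w i * r i * rho i)).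
  by apply: eq_bigr => i _; rewrite -/(h i); ring.
have mean0 : \sum_i w i * rho i = 0.
  rewrite /rho /energy_dev; under eq_bigr do rewrite mulrBr.
  by rewrite sumrB (equilibrium_energy eqy) -mulr_suml (equilibrium_mass eqy) mul1r subrr.
have orth : \sum_i w i * (r i * h i) = 0 by exact: equilibrium_orth eqy z.
have dwE i : w_of s i 0 = - (mu2 * (w i * (r i * h i - al * rho i))).
  by rewrite ws mxE.
have dmass : \sum_i w_of s i 0 = 0.
  transitivity (- mu2 * (\sum_i w i * (r i * h i) - al * \sum_i w i * rho i)).
    rewrite mulr_sumr -sumrB mulr_sumr; apply: eq_bigr => i _.
    by rewrite dwE; ring.
  by rewrite orth mean0 mulr0 subr0 mulr0.
have s0 : s *m 'J (F A b 0) y = 0.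
  rewrite diff_FE//.
  apply/rowP; apply: state_index_ind => [||i|j]; rewrite mk_stateE [RHS]mxE.
  - exact: dmass.
  - rewrite xs.
    transitivity (- mu2 * (\sum_i w i * (r i * h i * rho i) - al * energy_var E y)
        + E * (\sum_i w_of s i 0) + 2 * \sum_i w i * (r i * h i)).
      rewrite /energy_var !mulr_sumr -sumrB mulr_sumr -!big_split /=.
      apply: eq_bigr => i _; rewrite dwE -/(w i) -/(r i) -/(h i) -/(rho i).
      have -> : r i ^+ 2 = rho i + E by rewrite /rho /energy_dev subrK.
      ring.
    by rewrite dmass orth cov subrr !mulr0 !addr0.
  - rewrite mxE xs ls ms dwE -/(w i) -/(r i) -/(h i).
    have -> : r i ^+ 2 = rho i + E by rewrite /rho /energy_dev subrK.
    by rewrite /mu2; field; rewrite /w lt0r_neq0 ?w0.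
  - rewrite mxE xs.
    have : (reduced_hessian E y *m z) j 0 = 0 by rewrite Sz0 mxE.
    rewrite reduced_hessianE => Szj; rewrite -[RHS]Szj; apply: eq_bigr => i _.
    by rewrite dwE /mu2 -/(w i) -/(r i) -/(h i) -/(rho i) -/al; ring.
have {}s0 : s = 0 by rewrite -[s](mulmxK uJ) s0 mul0mx.
by rewrite -xs s0 /x_of; apply/matrixP => i j; rewrite !mxE.
Qed.

Lemma cvg_reduced_hessian (Y : R -> @state R m n) (t : R) j k :
  Y s @[s --> t] --> Y t -> energy_var t (Y t) != 0 ->
  reduced_hessian s (Y s) j k @[s --> t] --> reduced_hessian t (Y t) j k.
Proof.
move=> cY var0.
have cf (f : @state R m n -> R) :
    differentiable f (Y t) -> f (Y s) @[s --> t] --> f (Y t).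
  by move=> /differentiable_continuous cf; exact: continuous_cvg cf cY.
have cw i := cf _ (ex_diff (is_diff_def:=is_diff_w (Y t) i)).
have cr i := cf _ (ex_diff (is_diff_def:=is_diff_res A b (Y t) i)).
have cr2 i := cf _ (ex_diff (is_diff_def:=is_diff_res2 A b (Y t) i)).
have cmu := cf _ (ex_diff (is_diff_def:=is_diff_mu (Y t))).
have cc (a : R) : (fun _ : R => a) s @[s --> t] --> a by exact: cvg_cst.
have cdev i : energy_dev s (Y s) i @[s --> t] --> energy_dev t (Y t) i.
  exact: (cvgB (cr2 i) cvg_id).
have cvar : energy_var s (Y s) @[s --> t] --> energy_var t (Y t).
  apply: (cvg_ext _ _ (cvg_sum_ord (fun i =>
    cvgM (cw i) (cvgM (cdev i) (cdev i))))) => [s|];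
  by apply: eq_bigr => i _; rewrite expr2.
have ccov l : energy_cov s (Y s) l @[s --> t] --> energy_cov t (Y t) l.
  exact: (cvg_sum_ord (fun i => cvgM (cc (A i l)) (cvgM (cvgM (cw i) (cr i)) (cdev i)))).
apply: (cvg_ext _ _ (cvgB (cvg_sum_ord (fun i => cvgM (cc (A i j * A i k)) (cw i)))
  (cvgM (cvgM (cc 2) cmu)
    (cvgB (cvg_sum_ord (fun i => cvgM (cc (A i j * A i k)) (cvgM (cw i) (cr2 i))))
      (cvgM (cvgM (ccov j) (ccov k)) (cvgV var0 cvar)))))) => [s|]; by rewrite mxE.
Qed.

End reduced_hessian.

(** * The solution stays on the curve of equilibria *)

Lemma is_derive_comp_diff (R : realType) (V W : normedModType R) (y : R -> V)
    (F : V -> W) (t : R) (dy : V) :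
  is_derive t 1 y dy -> differentiable F (y t) ->
  is_derive t 1 (fun s => F (y s)) ('d F (y t) dy).
Proof.
move=> ydy dF; have dyt : differentiable y t.
  by apply/derivable1_diffP; exact: ex_derive.
have dFy : differentiable (F \o y) t by exact: differentiable_comp.
rewrite -[fun _ => _]/(F \o y).
apply: DeriveDef; first exact: diff_derivable.
rewrite [LHS](deriveE _ dFy) diff_comp//= -(deriveE (1 : R) dyt).
by rewrite (@derive_val _ _ _ _ _ _ _ ydy).
Qed.

Lemma is_derive_translate (R : realType) (V : normedModType R) (g : R -> V)
    (a t : R) (dg : V) :
  is_derive (t - a) 1 g dg -> is_derive t 1 (fun s => g (s - a)) dg.
Proof.
move=> [gt gE].
have E : (fun h : R => h^-1 *: (g (h *: 1%R + t - a) - g (t - a))) =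
    (fun h : R => h^-1 *: (g (h *: 1%R + (t - a)) - g (t - a))).
  by apply/funext => h; rewrite addrA.
by apply: DeriveDef; rewrite /derivable /derive E.
Qed.

Section solution_path.
Context {R : realType} {m n : nat}.
Variables (A : 'M[R]_(m, n)) (b : 'cV[R]_m) (a : R) (y : R -> @state R m n).
Hypotheses (m0 : (0 < m)%N) (rankA : \rank A = n).
Hypothesis sol : is_solution A b a y.

(** Freezing the solution at the right endpoint turns one-sided continuity there
    into continuity, so that no statement has to be relative to an interval. *)
Definition stopped (t : R) : @state R m n := y (Num.min t (E_uw A b)).

Lemma stoppedE t : t <= E_uw A b -> stopped t = y t.
Proof. by move=> tE; rewrite /stopped min_l. Qed.

(** y (E_uw + h) - y E_uw is h times a quotient that converges. *)
Lemma left_derivative_continuous :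
  y (E_uw A b + h) @[h --> 0^'-] --> y (E_uw A b).
Proof.
have [_ _ _ yl] := sol; set u := E_uw A b in yl *.
pose q h := h^-1 *: (y (u + h) - y u).
have H : h *: q h @[h --> (0 : R)^'-] --> (0 : R) *: ode_rhs A b (y u).
  apply: cvgZ; last exact: yl.
  by apply: cvg_within_filter; exact: cvg_id.
have {}H : y u + h *: q h @[h --> (0 : R)^'-] --> y u + (0 : R) *: ode_rhs A b (y u).
  by apply: cvgD => //; exact: cvg_cst.
rewrite scale0r addr0 in H; apply: cvg_trans H.
apply: near_eq_cvg; near=> h.
have h0 : h != 0 by rewrite lt_eqF//; near: h; exact: nbhs_left_lt.
by rewrite /q scalerA mulfV// scale1r addrC subrK.
Unshelve. all: by end_near. Qed.

Lemma stopped_continuous t : a < t -> stopped s @[s --> t] --> stopped t.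
Proof.
move=> at_; have [_ _ dy _] := sol; have [tE|Et|tE] := ltgtP t (E_uw A b).
- rewrite stoppedE ?ltW//.
  have yt : y s @[s --> t] --> y t.
    apply: differentiable_continuous; apply/derivable1_diffP.
    by apply: (@ex_derive _ _ _ _ _ _ _ (dy t _)); rewrite in_itv/= at_.
  apply: cvg_trans yt; apply: near_eq_cvg; near=> s.
  rewrite stoppedE//; near: s; apply: (cvgr_le t) => //; exact: cvg_id.
- have -> : stopped t = stopped (E_uw A b).
    by rewrite /stopped min_r ?ltW// minxx.
  apply: cvg_near_cst; near=> s; rewrite /stopped minxx min_r//.
  near: s; apply: (cvgr_ge t) => //; exact: cvg_id.
rewrite tE stoppedE//; apply/cvgrPdist_lt => e e0.
have /cvgrPdist_lt/(_ e e0) := left_derivative_continuous.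
move=> [d /= d0 dP].
near=> s; have [sE|Es] := ltP s (E_uw A b); last first.
  by rewrite /stopped min_r// subrr normr0.
rewrite stoppedE ?ltW//.
have -> : s = E_uw A b + (s - E_uw A b) by rewrite addrC subrK.
apply: dP => /=; last by rewrite subr_lt0.
rewrite sub0r opprB; near: s.
have /cvgrPdist_lt/(_ d d0) : s @[s --> E_uw A b] --> E_uw A b by exact: cvg_id.
by [].
Unshelve. all: by end_near. Qed.

Lemma e2_mk_state : (@e2 R m n)^T = mk_state 0 1 0 0.
Proof. by rewrite /e2 trmx_delta -delta_imuE. Qed.

Lemma ode_rhsE q : ode_rhs A b q = mk_state 0 1 0 0 *m invmx ('J (F A b 0) q).
Proof. by rewrite /ode_rhs /Jac trmx_mul e2_mk_state trmx_inv trmxK. Qed.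

(** By the chain rule and the equation, F (y E) - E e_2 has derivative
    J J^-1 e_2 - e_2 = 0, and it vanishes at E_uw. *)
Lemma solution_equilibrium E : E \in `]a, E_uw A b] -> equilibrium A b E (y E).
Proof.
have [yu dom dy _] := sol.
have w0 t : t \in `]a, E_uw A b] -> forall i, 0 < w_of (y t) i 0.
  by move=> /dom[[]].
move=> Ein; split; first exact: w0.
move: Ein; rewrite in_itv/= => /andP[aE1 EE].
set ev := mk_state 0 1 0 0; apply/rowP => k.
pose g (t : R) := F A b 0 (stopped t) 0 k - t * ev 0 k.
have dg (t : R) : t \in `]E, E_uw A b[ -> is_derive t 1 g 0.
  rewrite in_itv/= => /andP[Et tE].
  have at_ : a < t by exact: lt_trans Et.
  have wt : forall i, 0 < w_of (y t) i 0 by apply: w0; rewrite in_itv/= at_ ltW.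
  have dFt := is_diff_F A b wt.
  have yt : is_derive t 1 y (ode_rhs A b (y t)) by apply: dy; rewrite in_itv/= at_.
  have := is_derive_comp_diff yt (@ex_diff _ _ _ _ _ _ _ dFt).
  have -> : 'd (F A b 0) (y t) (ode_rhs A b (y t)) = ev.
    rewrite (@diff_val _ _ _ _ _ _ _ dFt) -(diff_FE A b _ wt) ode_rhsE mulmxKV//.
    have [_] : ode_domain (y t) /\ Jac A b (y t) \in unitmx.
      by apply: dom; rewrite in_itv/= at_ ltW.
    by rewrite /Jac unitmx_tr.
  move=> /(is_derive_coord 0 k) dFy.
  have dl : is_derive t 1 (fun s : R => s * ev 0 k) (ev 0 k).
    have D := is_diff_scalel t (ev 0 k : R^o).
    have dD : differentiable (fun s : R => s * ev 0 k) t.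
      exact: (@ex_diff _ _ _ _ _ _ _ D).
    apply: DeriveDef; first exact: diff_derivable.
    by rewrite deriveE// (@diff_val _ _ _ _ _ _ _ D) [LHS]mul1r.
  have := is_deriveB dFy dl; rewrite subrr.
  apply: near_eq_is_derive; near=> s.
  rewrite /g stoppedE//; near: s; apply: (cvgr_le t) => //; exact: cvg_id.
have cg : {within `[E, E_uw A b], continuous g}.
  apply: continuous_in_subspaceT => t; rewrite inE/= in_itv/= => /andP[Et tE].
  have at_ : a < t by exact: lt_le_trans Et.
  have wt : forall i, 0 < w_of (stopped t) i 0.
    by rewrite stoppedE//; apply: w0; rewrite in_itv/= at_.
  apply: cvgB.
    have cF := differentiable_continuous (@ex_diff _ _ _ _ _ _ _ (is_diff_F A b wt)).
    have cFs : F A b 0 (stopped s) @[s --> t] --> F A b 0 (stopped t).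
      exact: continuous_cvg cF (stopped_continuous at_).
    exact: (continuous_cvg _ (@coord_continuous R _ _ 0 k _) cFs).
  by apply: cvgMr_tmp; exact: cvg_id.
have [c _] := MVT_segment EE dg cg.
have scE (t : R) : (t *: ev) 0 k = t * ev 0 k by rewrite mxE.
rewrite mul0r /g !stoppedE// yu (equilibrium_y_star b rankA m0).2 -/ev !scE.
by rewrite subrr sub0r => /eqP; rewrite oppr_eq0 subr_eq0 => /eqP ->.
Unshelve. all: by end_near. Qed.

End solution_path.

(** * A priori bounds along the solution *)

Section bounds.
Context {R : realType} {m n : nat}.
Variables (A : 'M[R]_(m, n)) (b : 'cV[R]_m).

(** All ratios w k / w i are at most exp (M T), and the w k add up to 1. *)
Lemma gibbs_lower (w t : 'I_m -> R) (nu mu M T : R) :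
  (forall i, 0 < w i) -> \sum_i w i = 1 ->
  (forall i, ln (w i) + nu + mu * t i = 0) ->
  0 <= mu <= M -> (forall i, 0 <= t i <= T) ->
  forall i, expR (- (M * T)) <= m%:R * w i.
Proof.
move=> w0 w1 wt /andP[mu0 muM] tT i.
have lnKw j : expR (ln (w j)) = w j by apply: lnK; rewrite posrE.
rewrite -[leLHS]mul1r -[X in X * _ <= _]w1 mulr_suml.
have -> : m%:R * w i = \sum_(k < m) w i by rewrite sumr_const card_ord -[RHS]mulr_natl.
apply: ler_sum => k _; rewrite -(lnKw k) -(lnKw i) -expRD ler_expR.
have /andP[ti0 tiT] := tT i; have /andP[tk0 tkT] := tT k.
have h1 : mu * (t i - t k) <= M * T.
  have : mu * (t i - t k) <= mu * T by rewrite ler_wpM2l//; lra.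
  by move=> /le_trans; apply; rewrite ler_wpM2r//; lra.
have := wt i; have := wt k; lra.
Qed.

(** Orthogonality of r and A x gives sum w (A x)^2 = sum w b (A x), so
    sum w (A x)^2 <= sum w b^2 <= |b|^2, and coercivity concludes. *)
Lemma equilibrium_x_bounded (E s0 : R) (y : @state R m n) :
  0 < s0 -> equilibrium A b E y ->
  loewner_ge (A^T *m W_of y *m A) (s0 ^+ 2) ->
  `|x_of y| <= Num.sqrt (\sum_i b i 0 ^+ 2) / s0.
Proof.
move=> s00 eqy coer; have w0 := eqy.1.
pose h i : R := (A *m x_of y) i 0; pose w i : R := w_of y i 0.
have B0 : 0 <= \sum_i b i 0 ^+ 2 by apply: sumr_ge0 => i _; exact: sqr_ge0.
have hb : \sum_i w i * h i ^+ 2 <= \sum_i b i 0 ^+ 2.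
  have orth := equilibrium_orth eqy (x_of y).
  have e : \sum_i w i * h i ^+ 2 = \sum_i w i * (b i 0 * h i).
    apply/eqP; rewrite -subr_eq0 -[X in _ == X]orth -sumrB; apply/eqP.
    apply: eq_bigr => i _.
    have -> : res_of A b y i 0 = h i - b i 0 by rewrite /res_of !mxE /h mxE.
    by rewrite -/(h i) -/(w i); ring.
  have : 2 * (\sum_i w i * (b i 0 * h i)) <=
      \sum_i (w i * h i ^+ 2 + b i 0 ^+ 2).
    rewrite mulr_sumr; apply: ler_sum => i _.
    have h1 : w i * (b i 0 ^+ 2) <= b i 0 ^+ 2.
      by rewrite ler_piMl ?sqr_ge0// (equilibrium_w_le1 eqy).
    have h2 : 0 <= w i * (h i - b i 0) ^+ 2 by rewrite mulr_ge0 ?sqr_ge0 ?ltW// w0.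
    by move: h1 h2; nra.
  by rewrite big_split /= -e; lra.
have h1 : s0 ^+ 2 * `|x_of y| ^+ 2 <= \sum_i b i 0 ^+ 2.
  apply: le_trans hb; apply: le_trans (loewner_sum (x_of y) coer).
  by rewrite ler_pM2l ?exprn_gt0// norm_sqr_le_sum.
rewrite ler_pdivlMr// -(@ler_pXn2r _ 2) ?nnegrE ?mulr_ge0 ?sqrtr_ge0 ?(ltW s00)//.
by rewrite sqr_sqrtr// exprMn mulrC.
Qed.

Lemma res_bounded (y : @state R m n) (X : R) i : `|x_of y| <= X ->
  `|res_of A b y i 0| <= n%:R * `|A| * X + `|b|.
Proof.
move=> xX; have -> : res_of A b y i 0 = (A *m x_of y) i 0 - b i 0.
  by rewrite /res_of; move: (A *m x_of y) => u; rewrite !mxE.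
apply: le_trans (ler_normB _ _) _; apply: lerD; last exact: mx_coord_le.
by apply: le_trans (mulmx_coord_le _ _ _) _; rewrite ler_wpM2l// mulr_ge0.
Qed.

Lemma state_norm_le (y : @state R m n) (L : R) : 0 <= L ->
  `|lam_of y| <= L -> `|mu_of y| <= L -> (forall i, `|w_of y i 0| <= L) ->
  `|x_of y| <= L -> `|y| <= L.
Proof.
move=> L0 lL muL wL xL; apply: mx_norm_le => // i k; rewrite ord1.
move: k; apply: state_index_ind => [||k|j].
- by rewrite -lam_ofE.
- by rewrite -mu_ofE.
- by rewrite -w_ofE.
- by rewrite -x_ofE; apply: le_trans xL; exact: mx_coord_le.
Qed.

End bounds.

Section maximal_path.
Context {R : realType} {m n : nat}.
Variables (A : 'M[R]_(m, n)) (b : 'cV[R]_m) (Emin s0 : R) (y : R -> @state R m n).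
Hypotheses (n0 : (0 < n)%N) (m0 : (0 < m)%N) (rankA : \rank A = n).
Hypothesis hr : ~ exists c : R, forall i, `|ls_residual A b i 0| = c.
Hypotheses (sol : is_solution A b Emin y) (EminE : Emin < E_uw A b).
Hypotheses (Emin0 : 0 < Emin) (s00 : 0 < s0).
Hypothesis coer : forall E, E \in `]Emin, E_uw A b] ->
  loewner_ge (A^T *m W_of (y E) *m A) (s0 ^+ 2).

Let eqy E : E \in `]Emin, E_uw A b] -> equilibrium A b E (y E).
Proof. exact: (solution_equilibrium m0 rankA sol). Qed.

Let var0 E : E \in `]Emin, E_uw A b] -> energy_var A b E (y E) != 0.
Proof.
by move=> Ein; rewrite gt_eqF//; exact: (equilibrium_variance_gt0 rankA (eqy Ein) hr).
Qed.

Let mu_uw : mu_of (y (E_uw A b)) = 0.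
Proof.
have [-> _ _ _] := sol.
by rewrite mu_ofE /y_star mk_stateE.
Qed.

Lemma path_mu_ge0 E : E \in `]Emin, E_uw A b] -> 0 <= mu_of (y E).
Proof.
move=> Ein; have := Ein; rewrite in_itv/= => /andP[_].
rewrite le_eqVlt => /predU1P[->|EE]; first by rewrite mu_uw.
exact: (equilibrium_mu_ge0 rankA (eqy Ein) EE).
Qed.

(** Positive definiteness of the reduced Hessian is inherited from E_uw, where
    mu = 0, by continuation along the interval. *)
Lemma path_second_order E : E \in `]Emin, E_uw A b] -> second_order A b E (y E).
Proof.
move=> Ein; apply: second_order_reduced_hessian; first exact: var0.
have uwin : E_uw A b \in `]Emin, E_uw A b] by rewrite in_itv/= EminE lexx.
have le_uw t : t \in `]Emin, E_uw A b] -> t <= E_uw A b.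
  by rewrite in_itv/= => /andP[].
pose G t := reduced_hessian A b t (stopped A b y t).
have GE t : t \in `]Emin, E_uw A b] -> G t = reduced_hessian A b t (y t).
  by move=> tin; rewrite /G stoppedE// le_uw.
rewrite -GE//.
apply: (@posdef_continuation _ _ G [set` `]Emin, E_uw A b]] (E_uw A b)) => //.
- exact/connected_intervalP/interval_is_interval.
- move=> t i j /= tin; apply: cvg_reduced_hessian.
    apply: (stopped_continuous sol).
    by move: tin; rewrite in_itv/= => /andP[].
  by rewrite stoppedE ?le_uw//; exact: var0.
- by move=> t _; exact: reduced_hessian_sym.
- move=> t /= tin; rewrite GE//; apply: reduced_hessian_unitmx; [exact: eqy|exact: var0|].
  by have [_ dom _ _] := sol; have [] := dom t tin.
- rewrite GE// => z z0; rewrite bil_reduced_hessian ?var0// mu_uw mulr0 mul0r subr0.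
  apply: lt_le_trans (loewner_sum z (coer uwin)).
  by rewrite mulr_gt0 ?exprn_gt0 ?sum_sqr_gt0.
Qed.

Let X := Num.sqrt (\sum_i b i 0 ^+ 2) / s0.

Let x_le E : E \in `]Emin, E_uw A b] -> `|x_of (y E)| <= X.
Proof. by move=> Ein; exact: (equilibrium_x_bounded s00 (eqy Ein) (coer Ein)). Qed.

Lemma path_mu_bounded_away (E1 : R) : Emin < E1 -> exists M : R,
  forall E, E1 <= E <= E_uw A b -> mu_of (y E) <= M.
Proof.
move=> E1m; have [E1u|uE1] := leP E1 (E_uw A b); last first.
  by exists 0 => E /andP[E1E EE]; move: uE1; rewrite ltNge (le_trans E1E EE).
pose f t := mu_of (stopped A b y t).
have cf : {within `[E1, E_uw A b], continuous f}.
  apply: continuous_in_subspaceT => t; rewrite inE/= in_itv/= => /andP[Et tE].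
  have ct := stopped_continuous sol (lt_le_trans E1m Et).
  have := differentiable_continuous (ex_diff (is_diff_def:=is_diff_mu (stopped A b y t))).
  by move=> cmu; exact: continuous_cvg cmu ct.
have [c cin cmax] := EVT_max E1u cf.
exists (f c) => E Ein; have := cmax E; rewrite in_itv/= Ein => /(_ isT).
by rewrite /f stoppedE//; case/andP: Ein.
Qed.

(** On [E1, E_uw] continuity bounds mu, so an unbounded mu would blow up along
    parameters that decrease to Emin and along which x converges. *)
Lemma path_mu_bounded : exists M : R,
  forall E, E \in `]Emin, E_uw A b] -> mu_of (y E) <= M.
Proof.
apply: contrapT => unb.
have big M : exists2 E, E \in `]Emin, E_uw A b] & M < mu_of (y E).
  apply: contrapT => nE; apply: unb; exists M => E Ein.
  by rewrite leNgt; apply/negP => MmuE; apply: nE; exists E.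
pose Q d E := [/\ E \in `]Emin, E_uw A b] & 1 < d * mu_of (y E)].
have Qle d d' E : d <= d' -> Q d E -> Q d' E.
  move=> dd' [Ein muE]; split => //; apply: lt_le_trans muE _.
  by rewrite ler_wpM2r// path_mu_ge0.
have Qex d : 0 < d ->
    exists E, [/\ Emin < E < Emin + d, Q d E & `|(x_of (y E))^T| <= X].
  move=> d0.
  have Ed : Emin < Emin + d by rewrite ltrDl.
  have [M1 M1P] := path_mu_bounded_away Ed.
  have [E Ein muE] := big (Num.max M1 d^-1).
  have [EminE' EE] : Emin < E /\ E <= E_uw A b.
    by move: Ein; rewrite in_itv/= => /andP[].
  move: muE; rewrite gt_max => /andP[M1E dE]; exists E; split.
  - rewrite EminE' ltNge; apply/negP => dEE.
    by have := M1P E; rewrite dEE EE => /(_ isT); rewrite leNgt M1E.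
  - by split => //; rewrite mulrC -ltr_pdivrMr// div1r.
  - apply: le_trans (x_le Ein); apply: mx_norm_le => // i j.
    by rewrite ord1; apply: le_trans (mx_coord_le _ j 0); rewrite !mxE.
have [p pP] := frequently_cluster Qle Qex.
apply: (multiplier_no_blow_up (A := A) (b := b) (xb := p^T) n0 Emin0 s00) => d d0.
have [E [Ed [Ein muE] xp]] := pP d d0.
exists E, (y E); split;
  [exact: Ed|exact: eqy|exact: coer|exact: path_second_order|].
split => //; apply: le_lt_trans xp; apply: mx_norm_le => // i j.
by rewrite ord1; apply: le_trans (mx_coord_le _ 0 i); rewrite !mxE.
Qed.

Lemma path_weights_bounded_below : exists2 c : R, 0 < c &
  forall E, E \in `]Emin, E_uw A b] -> forall i, c <= w_of (y E) i 0.
Proof.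
have [M MP] := path_mu_bounded.
pose K := n%:R * `|A| * X + `|b|.
have K0 E (i : 'I_m) : E \in `]Emin, E_uw A b] ->
    0 <= res_of A b (y E) i 0 ^+ 2 <= K ^+ 2.
  move=> Ein; rewrite sqr_ge0/= -[leLHS]real_normK ?num_real//.
  have rK := res_bounded A b i (x_le Ein).
  by rewrite lerXn2r ?nnegrE// (le_trans _ rK).
exists (expR (- (M * K ^+ 2)) / m%:R); first by rewrite divr_gt0 ?expR_gt0 ?ltr0n.
move=> E Ein i; rewrite ler_pdivrMr ?ltr0n// [leRHS]mulrC.
apply: (gibbs_lower (eqy Ein).1 (equilibrium_mass (eqy Ein))
  (equilibrium_gibbs (eqy Ein))).
  by rewrite path_mu_ge0// MP.
by move=> j; exact: K0.
Qed.

Lemma path_bounded : bounded_solution A b Emin y.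
Proof.
have [M MP] := path_mu_bounded; have [c c0 cP] := path_weights_bounded_below.
pose K := n%:R * `|A| * X + `|b|.
pose L := 1 + (`|M| + X) + (`|ln c| + `|M| * K ^+ 2).
have X0 : 0 <= X by rewrite divr_ge0 ?sqrtr_ge0// ltW.
have MK0 : 0 <= `|M| * K ^+ 2 by rewrite mulr_ge0 ?sqr_ge0.
have := normr_ge0 M; have := normr_ge0 (ln c) => lc0 M0.
exists L => E Ein; have eqE := eqy Ein.
have mu0 := path_mu_ge0 Ein; have muM := MP E Ein.
have M_le : M <= `|M| by exact: ler_norm.
apply: state_norm_le.
- by rewrite /L; lra.
- pose i := Ordinal m0.
  have := equilibrium_gibbs eqE i; have wi := cP E Ein i.
  have wi1 := equilibrium_w_le1 eqE i; have wi0 := eqE.1 i.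
  have l1 : ln c <= ln (w_of (y E) i 0) by rewrite ler_ln ?posrE.
  have l2 : ln (w_of (y E) i 0) <= 0 by rewrite -ln1 ler_ln ?posrE.
  have rK := res_bounded A b i (x_le Ein).
  have r2 : res_of A b (y E) i 0 ^+ 2 <= K ^+ 2.
    rewrite -[leLHS]real_normK ?num_real//.
    by rewrite lerXn2r ?nnegrE// (le_trans _ rK).
  have mr0 : 0 <= mu_of (y E) * res_of A b (y E) i 0 ^+ 2.
    by rewrite mulr_ge0 ?sqr_ge0.
  have mr : mu_of (y E) * res_of A b (y E) i 0 ^+ 2 <= `|M| * K ^+ 2.
    by rewrite ler_pM ?sqr_ge0//; lra.
  have lcc : - `|ln c| <= ln c by rewrite lerNl -normrN ler_norm.
  by move=> H; rewrite ler_norml /L; apply/andP; split; lra.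
- by rewrite ger0_norm// /L; lra.
- move=> i; rewrite gtr0_norm ?eqE.1//.
  by have := equilibrium_w_le1 eqE i; rewrite /L; lra.
- by have := x_le Ein; rewrite /L; lra.
Qed.

End maximal_path.

(** * Extension beyond the breakdown point *)

Lemma near_right_or_frequently (R : realType) (a : R) (f : R -> Prop) :
  (\forall t \near a^'+, f t) \/
  (forall d, 0 < d -> exists2 t, a < t < a + d & ~ f t).
Proof.
have [H|H] := pselect (\forall t \near a^'+, f t); [by left|right => d d0].
apply: contrapT => nf; apply: H; near=> t; apply: contrapT => nft; apply: nf.
exists t => //; apply/andP; split; near: t; first exact: nbhs_right_gt.
by apply: nbhs_right_lt; rewrite ltrDl.
Unshelve. all: by end_near. Qed.

Section extension.
Context {R : realType} {m n : nat}.
Variables (A : 'M[R]_(m, n)) (b : 'cV[R]_m) (Emin : R) (y : R -> @state R m n).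
Variable p : @state R m n.
Hypotheses (m0 : (0 < m)%N) (rankA : \rank A = n).
Hypotheses (sol : is_solution A b Emin y) (EminE : Emin < E_uw A b).
Hypothesis Emin0 : 0 < Emin.
Hypothesis p_cluster : forall d, 0 < d ->
  exists E, [/\ Emin < E < Emin + d, E <= E_uw A b & `|y E - p| < d].
Hypotheses (wp : forall i, 0 < w_of p i 0) (Jp : 'J (F A b 0) p \in unitmx).

(** F p is the limit of F (y E) = E e_2 along parameters E that tend to Emin. *)
Lemma cluster_equilibrium : equilibrium A b Emin p.
Proof.
split => //; apply/subr0_eq/normr0_eq0/eqP; rewrite eq_le normr_ge0 andbT.
apply/ler_addgt0Pl => e e0; rewrite addr0.
set ev := mk_state 0 1 0 0.
have cF := differentiable_continuous (@ex_diff _ _ _ _ _ _ _ (is_diff_F A b wp)).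
have /cvgrPdist_lt/(_ (e / 2)) := cF; rewrite divr_gt0// => /(_ isT).
move=> /nbhs_normP[r /= r0 rP].
pose d := Num.min r (e / 2 / (`|ev| + 1)).
have d0 : 0 < d by rewrite lt_min r0 !divr_gt0// ltr_wpDl.
have [E [/andP[E1 E2] EE yp]] := p_cluster d0.
have Ein : E \in `]Emin, E_uw A b] by rewrite in_itv/= E1.
have FE := (solution_equilibrium m0 rankA sol Ein).2.
have h1 : `|F A b 0 p - F A b 0 (y E)| < e / 2.
  by apply: rP; rewrite /= distrC; apply: lt_le_trans yp _; rewrite ge_min lexx.
have h2 : `|E *: ev - Emin *: ev| <= e / 2.
  rewrite -scalerBl normrZ gtr0_norm ?subr_gt0//.
  have dE : E - Emin <= e / 2 / (`|ev| + 1).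
    by rewrite lerBlDl (le_trans (ltW E2))// lerD2l ge_min lexx orbT.
  apply: (@le_trans _ _ (e / 2 / (`|ev| + 1) * `|ev|)); first by rewrite ler_wpM2r.
  rewrite mulrAC ler_pdivrMr ?ltr_wpDl// ler_wpM2l ?divr_ge0 ?(ltW e0)//.
  by rewrite lerDl.
rewrite -(subrK (F A b 0 (y E)) (F A b 0 p)) {2}FE -addrA.
rewrite (le_trans (ler_normD _ _))// (splitr e) lerD// ltW//.
Qed.

(** The equilibrium curve g through p agrees with y just to the right of Emin:
    once y is within r of p it equals g, hence is within r / 2 of p, and
    connectedness carries this down to Emin.  The extension z is y to the right
    of Emin and g to its left. *)
Lemma solution_extends : exists a z, [/\ 0 <= a, a < Emin, is_solution A b a z &
  forall E, E \in `]Emin, E_uw A b] -> z E = y E].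
Proof.
set ev : @state R m n := mk_state 0 1 0 0.
have [_ Fp] := cluster_equilibrium.
have cJ i j : {for p, continuous (fun q => 'J (F A b 0) q i j)}.
  exact: continuous_jacobian_F.
have [g [d [r [d0 r0 gP guniq]]]] := local_solution_curve ev (w_pos_near wp)
  (differentiable_F_near A b wp) cJ Jp.
have geq t : `|t| < d -> equilibrium A b (Emin + t) (g t).
  move=> /gP[_ w0 _ Fg _]; split; first exact: w0.
  by rewrite Fg Fp scalerDl.
have dr0 : 0 < Num.min d r by rewrite lt_min d0.
have [E1 [/andP[E1l E1r] E1u yE1]] := p_cluster dr0.
have {}E1r : E1 < Emin + d by apply: lt_le_trans E1r _; rewrite lerD2l ge_min lexx.
have {}yE1 : `|y E1 - p| < r by apply: lt_le_trans yE1 _; rewrite ge_min lexx orbT.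
have in1 E : E \in `]Emin, E1] ->
    [/\ Emin < E, E <= E_uw A b & `|E - Emin| < d].
  rewrite in_itv/= => /andP[lE Er]; split => //; first exact: le_trans E1u.
  by rewrite gtr0_norm ?subr_gt0// ltrBlDl (le_lt_trans Er).
have yg E : E \in `]Emin, E1] -> `|y E - p| < r -> y E = g (E - Emin).
  move=> /in1[lE Eu Ed] yr; apply: guniq => //.
  have Ein : E \in `]Emin, E_uw A b] by rewrite in_itv/= lE.
  rewrite (solution_equilibrium m0 rankA sol Ein).2 Fp -/ev -scalerDl.
  by rewrite addrC subrK.
have dist_cont E : E \in `]Emin, E1] ->
    `|stopped A b y s - p| @[s --> E] --> `|y E - p|.
  move=> /in1[lE Eu _]; rewrite -(stoppedE y Eu).
  apply: cvg_norm; apply: cvgB; last exact: cvg_cst.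
  exact: (stopped_continuous sol lE).
have close E : E \in `]Emin, E1] -> `|y E - p| < r.
  apply: (@connected_clopen_ind _ [set` `]Emin, E1]] [set E | `|y E - p| < r]) => /=.
  - exact/connected_intervalP/interval_is_interval.
  - by exists E1 => //=; rewrite in_itv/= E1l lexx.
  - move=> t tin tr; have /cvgr_lt/(_ _ tr) := dist_cont t tin.
    apply: filterS => s sr sin; have [_ su _] := in1 s sin.
    by rewrite -(stoppedE y su).
  - move=> t tin /negP; rewrite -leNgt => rt.
    have rt2 : r / 2 < `|y t - p| by apply: lt_le_trans rt; lra.
    have /cvgr_gt/(_ _ rt2) := dist_cont t tin.
    apply: filterS => s sr sin yr; have [_ su sd] := in1 s sin.
    move: sr; rewrite (stoppedE y su) (yg s sin yr) ltNge.
    by have [-> _ _ _ _] := gP _ sd.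
have [yu dom dy yl] := sol.
(* The problem is posed for nonnegative parameters only; a < Emin because Emin > 0. *)
pose a := Num.max 0 (Emin - d).
pose z E := if Emin < E then y E else g (E - Emin).
have zy E : Emin < E -> z E = y E by rewrite /z => ->.
have a0 : 0 <= a by rewrite le_max lexx.
have aEmin : a < Emin by rewrite gt_max Emin0 gtrBl.
have near_d E : a < E -> E <= Emin -> `|E - Emin| < d.
  rewrite gt_max => /andP[_ Ed] EE; rewrite ler0_norm ?subr_le0// opprB.
  by rewrite ltrBlDr -ltrBlDl.
have zg E : a < E -> E <= E1 -> z E = g (E - Emin).
  move=> aE EE1; rewrite /z; case: ifPn => // lE.
  have Ein : E \in `]Emin, E1] by rewrite in_itv/= lE.
  by apply: yg => //; exact: close.
exists a, z; split; [exact: a0|exact: aEmin| |]; last first.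
  by move=> E; rewrite in_itv/= => /andP[+ _]; exact: zy.
split.
- by rewrite zy.
- move=> E; rewrite in_itv/= => /andP[aE EE]; have [lE|El] := ltP Emin E.
    by rewrite zy//; apply: dom; rewrite in_itv/= lE.
  have Ed := near_d E aE El; rewrite zg ?(le_trans El (ltW E1l))//.
  have [_ w0 uJ _ _] := gP _ Ed; split; last by rewrite /Jac unitmx_tr.
  by split => //; exact: equilibrium_mass (geq _ Ed).
- move=> E; rewrite in_itv/= => /andP[aE EE]; have [lE|El] := ltP Emin E.
    rewrite zy//; apply: (@near_eq_is_derive _ _ _ y); last first.
      by apply: dy; rewrite in_itv/= lE.
    near=> s; apply/esym/zy; near: s; apply: (cvgr_gt E) => //; exact: cvg_id.
  have Ed := near_d E aE El; have EE1 : E < E1 by exact: le_lt_trans E1l.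
  have [_ _ _ _ dg] := gP _ Ed.
  rewrite (zg E aE (ltW EE1)) ode_rhsE.
  apply: (near_eq_is_derive _ (is_derive_translate dg)).
  near=> s; apply/esym/zg; near: s.
    by apply: (cvgr_gt E) => //; exact: cvg_id.
  by apply: (cvgr_le E) => //; exact: cvg_id.
- rewrite (zy _ EminE); apply: cvg_trans yl; apply: near_eq_cvg; near=> h.
  rewrite (zy (E_uw A b + h))// -ltrBlDl; near: h; apply: nbhs_left_gt.
  by rewrite subr_lt0.
Unshelve. all: by end_near. Qed.

End extension.

Theorem proposition4 (R : realType) (m n : nat) (A : 'M[R]_(m, n))
    (b : 'cV[R]_m) (Emin : R) (y : R -> @state R m n) (s0 : R)
    (hn : (0 < n)%N) (hmn : (n <= m)%N) (hA : \rank A = n)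
    (hr : ~ exists c : R, forall i, `|ls_residual A b i 0| = c)
    (hy : is_maximal_solution A b Emin y)
    (hEmin : 0 < Emin)
    (hs0 : 0 < s0)
    (hW : forall E, E \in `]Emin, E_uw A b] ->
            loewner_ge (A^T *m W_of (y E) *m A) (s0 ^+ 2)) :
  [/\ ~ blow_up Emin y,
      ~ reaches_boundary A b Emin y &
      loses_invertibility A b Emin y].
Proof.
have m0 : (0 < m)%N by exact: leq_trans hmn.
have [_ EminE sol maxl] := hy.
have bnd : bounded_solution A b Emin y.
  exact: (path_bounded hn m0 hA hr sol EminE hEmin hs0 hW).
have [c c0 cP] := path_weights_bounded_below hn m0 hA hr sol EminE hEmin hs0 hW.
have right_in : \forall E \near Emin^'+, E \in `]Emin, E_uw A b].
  near=> E; rewrite in_itv/=; apply/andP; split; near: E.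
    exact: nbhs_right_gt.
  exact: nbhs_right_le.
split.
- move=> /cvgryPgt blow; have [M MP] := bnd.
  have [E [Ein ME]] := filter_ex (filterI right_in (blow M)).
  by move: ME; rewrite ltNge MP.
- move=> [_ [i wi0]].
  have /cvgr_lt/(_ _ c0) := wi0.
  move=> /(filterI right_in)/filter_ex[E [Ein]].
  by rewrite ltNge cP.
split => //; first by exists c.
apply/cvgrPdist_lt => e e0.
have [//|freq] :=
  near_right_or_frequently Emin (fun E => `|0 - \det (Jac A b (y E))| < e).
exfalso; have [M MP] := bnd.
pose Q (d E : R) := E <= E_uw A b /\ e <= `|\det ('J (F A b 0) (y E))|.
have [||p pP] := @frequently_cluster _ _ y Emin M Q.
- by move=> d d' E _.
- move=> d d0; have d'0 : 0 < Num.min d (E_uw A b - Emin).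
    by rewrite lt_min d0 subr_gt0.
  have [E /andP[lE Er] nE] := freq _ d'0.
  have Ed : E < Emin + d by apply: lt_le_trans Er _; rewrite lerD2l ge_min lexx.
  have Eu : E <= E_uw A b.
    apply: ltW; apply: lt_le_trans Er _.
    by rewrite -lerBrDl ge_min lexx orbT.
  exists E; split; [by rewrite lE|split => //|by apply: MP; rewrite in_itv/= lE].
  by move: nE => /negP; rewrite -leNgt sub0r normrN /Jac det_tr.
have cl (P : set (@state R m n)) : nbhs p P ->
    exists E, [/\ E \in `]Emin, E_uw A b], e <= `|\det ('J (F A b 0) (y E))| & P (y E)].
  move=> /nbhs_normP[r /= r0 rP]; have [E [/andP[lE _] [Eu eE] yp]] := pP r r0.
  by exists E; split => //; [rewrite in_itv/= lE|apply: rP; rewrite /= distrC].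
have wp i : 0 < w_of p i 0.
  apply: (lt_le_trans c0); rewrite leNgt; apply/negP => wc.
  have cw := differentiable_continuous (ex_diff (is_diff_def:=is_diff_w p i)).
  have /cvgr_lt/(_ _ wc)/cl[E [Ein _]] := cw.
  by rewrite ltNge cP.
have Jp : 'J (F A b 0) p \in unitmx.
  rewrite unitmxE unitfE; apply/eqP => det0.
  have cJ i j : {for p, continuous (fun q => 'J (F A b 0) q i j)}.
    exact: continuous_jacobian_F.
  have cdet : \det ('J (F A b 0) q) @[q --> p] --> (0 : R).
    apply: (eq_ind _ (fun l : R => \det ('J (F A b 0) q) @[q --> p] --> l) _ _ det0).
    exact: (@cvg_det _ _ _ (fun q => 'J (F A b 0) q) _ (nbhs p) _ cJ).
  have /cvgrPdist_lt/(_ e e0)/cl[E [_ eE]] := cdet.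
  by rewrite sub0r normrN ltNge eE.
apply: maxl; apply: (solution_extends (p := p)) => //.
by move=> d d0; have [E [Ed [Eu _] yp]] := pP d d0; exists E.
Unshelve. all: by end_near. Qed.
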